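(* The $C^*$-subalgebra $C(S^2_{q\infty}/\mathbb{Z}_2):=\{a\in C(S^2_{q\infty})\mid\bar r_1(a)=a\}$ of $\mathbb{Z}_2$-invariants in $C(S^2_{q\infty})$ coincides with the $C^*$-completion (norm closure) of $P(S^2_{q\infty}/\mathbb{Z}_2)$ inside $C(S^2_{q\infty})$, and is isomorphic to $C(D_{q^4})$.
   Context: Fix $q\in\mathbb{R}$ with $0<|q|<1$. All algebras are unital and over $\mathbb{C}$. The $C^*$-closure of a $*$-algebra means the completion with respect to the supremum norm over all $*$-representations in bounded operators. $C(S^2_{q\infty})$ is the $C^*$-closure of $P(S^2_{q\infty})$, the quotient of the free $*$-algebra $\mathbb{C}\langle A,B\rangle$ by the two-sided $*$-ideal generated by $A^*=A$, $BA=q^2AB$, $B^*B=-A^2+I$, $BB^*=-q^4A^2+I$. For $0<s<1$, $C(D_s)$ is the $C^*$-closure (obtained from $*$-representations in bounded operators) of the $*$-algebra $P(D_s)=\mathbb{C}\langle x,x^*\rangle/J_s$, where $J_s$ is the two-sided ideal generated by $x^*x-s\,xx^*=1-s$. Here $s=q^4$. $r_1$ is the $*$-automorphism of $P(S^2_{q\infty})$ with $r_1(A)=-A$, $r_1(B)=B$, and $P(S^2_{q\infty}/\mathbb{Z}_2):=\{a\in P(S^2_{q\infty})\mid r_1(a)=a\}$. Let $\{e_k\}_{k\in\mathbb{N}}$ ($k\ge0$) be an orthonormal basis of a Hilbert space; representations $\pi_\pm$ of $C(S^2_{q\infty})$ are given by $\pi_\pm(A)e_k=\pm q^{2k}e_k$,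 $\pi_\pm(B)e_k=(1-q^{4k})^{1/2}e_{k-1}$ for $k\ge1$, $\pi_\pm(B)e_0=0$. Let $C^*(\mathfrak{S})$ be the $C^*$-algebra generated by the one-sided shift $\mathfrak{S}e_i=e_{i+1}$, $\sigma:C^*(\mathfrak{S})\to C(S^1)$ the symbol map ($\mathfrak{S}\mapsto u$, the unitary generator of $C(S^1)$), and $C^*(\mathfrak{S})\oplus_\sigma C^*(\mathfrak{S}):=\{(a_1,a_2)\mid\sigma(a_1)=\sigma(a_2)\}$. It is known that $\pi_+\oplus\pi_-:C(S^2_{q\infty})\to C^*(\mathfrak{S})\oplus_\sigma C^*(\mathfrak{S})$ is a $C^*$-isomorphism. With the flip $\tau(a,b)=(b,a)$ on $C^*(\mathfrak{S})\oplus_\sigma C^*(\mathfrak{S})$, the automorphism $\bar r_1$ of $C(S^2_{q\infty})$, extending $r_1$, is $\bar r_1:=(\pi_+\oplus\pi_-)^{-1}\circ\tau\circ(\pi_+\oplus\pi_-)$. *)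

(* Defs.v *)
From HB Require Import structures.
From mathcomp Require Import all_boot all_order all_algebra.
From mathcomp Require Import generic_quotient finmap complex.
From mathcomp Require Import boolp classical_sets functions reals ereal.
From mathcomp Require Import topology normedtype.
From mathcomp.multinomials Require monalg.
(* The notations of monalg clash with those of MathComp-Analysis. *)
Import -(notations) monalg.
Import numFieldNormedType.Exports.

Set Implicit Arguments.
Unset Strict Implicit.
Unset Printing Implicit Defensive.
Import Order.TTheory GRing.Theory Num.Theory.
Local Open Scope ring_scope.
Local Open Scope quotient_scope.
Local Open Scope classical_set_scope.

(* Unital *-algebras. The product is part of this structure, instead of being
   inherited from GRing.Algebra, so that it can be joined below with a norm: the
   only common extension of rings and normed modules allowed by MathComp is
   numDomainType. *)
HB.mixin Record isStarAlgebra (C : numClosedFieldType) A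
    of GRing.Lmodule C A := {
  sone : A;
  smul : A -> A -> A;
  smulA : associative smul;
  smul1 : left_id sone smul;
  smulr1 : right_id sone smul;
  smulDl : left_distributive smul +%R;
  smulDr : right_distributive smul +%R;
  smulZl : forall (c : C) (a b : A), smul (c *: a) b = c *: smul a b;
  smulZr : forall (c : C) (a b : A), smul a (c *: b) = c *: smul a b;
  star : A -> A;
  starK : involutive star;
  starD : forall a b : A, star (a + b) = star a + star b;
  starZ : forall (c : C) (a : A), star (c *: a) = c^* *: star a;
  starM : forall a b : A, star (smul a b) = smul (star b) (star a)
}.

#[short(type="starAlgType")]
HB.structure Definition StarAlgebra (C : numClosedFieldType) :=
  {A of GRing.Lmodule C A & isStarAlgebra C A}.

Notation "a ** b" := (smul a b) (at level 40, left associativity) : ring_scope.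

Record is_star_hom (C : numClosedFieldType) (A B : starAlgType C)
    (f : A -> B) : Prop := IsStarHom {
  star_homD : forall a b, f (a + b) = f a + f b;
  star_homZ : forall (c : C) a, f (c *: a) = c *: f a;
  star_homM : forall a b, f (a ** b) = f a ** f b;
  star_hom1 : f sone = sone;
  star_hom_star : forall a, f (star a) = star (f a)
}.

Section MonoidStarAlgebra.
Variables (C : numClosedFieldType) (K : monomType) (inv : K -> K).
Hypothesis invK : involutive inv.
Hypothesis invM : forall v w, inv (monalg.mul v w) = monalg.mul (inv w) (inv v).

Local Notation F := (malg K C).

Definition malg_star (g : F) : F :=
  \sum_(w <- msupp g) mkmalgU (inv w) (mcoeff w g)^*.

Lemma mcoeff_malg_star g w : mcoeff w (malg_star g) = (mcoeff (inv w) g)^*.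
Proof.
rewrite /malg_star raddf_sum /=.
under eq_bigr => v _ do rewrite mcoeffU -(inj_eq (inv_inj invK)) invK.
case: (msuppP g (inv w)) => [wg|wg].
  rewrite (big_fsetD1 (inv w)) //= eqxx mulr1n big1_fset ?addr0 // => v.
  by rewrite in_fsetD1 => /andP[/negPf -> _].
rewrite conjC0 big1_fset // => v vg _.
by case: eqP => // vw; rewrite vw (negPf wg) in vg.
Qed.

Lemma malg_starK : involutive malg_star.
Proof. by move=> g; apply/malgP => w; rewrite !mcoeff_malg_star invK conjCK. Qed.

Lemma malg_starD (g h : F) : malg_star (g + h) = malg_star g + malg_star h.
Proof.
by apply/malgP => w; rewrite mcoeffD !mcoeff_malg_star mcoeffD rmorphD.
Qed.

Lemma malg_starZ (c : C) (g : F) : malg_star (c *: g) = c^* *: malg_star g.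
Proof.
by apply/malgP => w; rewrite mcoeffZ !mcoeff_malg_star mcoeffZ rmorphM.
Qed.

Lemma malg_starU w (c : C) : malg_star (mkmalgU w c) = mkmalgU (inv w) c^*.
Proof.
apply/malgP => v; rewrite mcoeff_malg_star !mcoeffU.
rewrite -(inj_eq (inv_inj invK)) invK.
by case: eqP => _; rewrite ?mulr1n ?mulr0n ?conjC0.
Qed.

Lemma malg_star0 : malg_star 0 = 0.
Proof. by apply/malgP => w; rewrite mcoeff_malg_star !mcoeff0 conjC0. Qed.

Lemma malg_star_sum (I : Type) (r : seq I) (G : I -> F) :
  malg_star (\sum_(i <- r) G i) = \sum_(i <- r) malg_star (G i).
Proof. exact: (big_morph _ malg_starD malg_star0). Qed.

Lemma malg_starM (g h : F) : malg_star (g * h) = malg_star h * malg_star g.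
Proof.
rewrite [in LHS]malgME malg_star_sum [in RHS]/malg_star mulr_suml.
under eq_bigr => v _ do rewrite malg_star_sum.
rewrite exchange_big; apply: eq_bigr => w _; rewrite mulr_sumr.
apply: eq_bigr => v _; rewrite malg_starU invM.
have UM a b (x y : C) :
  mkmalgU a x * mkmalgU b y = mkmalgU (monalg.mul a b) (x * y) :> F
  by exact: fgmulUU.
by rewrite UM rmorphM mulrC.
Qed.

Lemma malg_mulZl (c : C) (g h : F) : (c *: g) * h = c *: (g * h).
Proof. by rewrite scalerAl. Qed.

Lemma malg_mulZr (c : C) (g h : F) : g * (c *: h) = c *: (g * h).
Proof.
apply/malgP => w; rewrite mcoeffZ.
rewrite (@mcoeffMlw _ _ (msupp g) (msupp h)) ?msuppZ_le //.
rewrite mcoeffMl mulr_sumr; apply: eq_bigr => u _.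
rewrite mulr_sumr; apply: eq_bigr => v _.
by rewrite mcoeffZ mulrnAr mulrCA.
Qed.
End MonoidStarAlgebra.

Section Words.
Variable n : nat.

Local Notation word := (fmonom ('I_n * bool)%type).

Definition word_star (w : word) : word :=
  FMonom (rev [seq (l.1, ~~ l.2) | l <- fmonom_val w]).

Lemma word_starK : involutive word_star.
Proof.
case=> s; rewrite /word_star /= map_rev revK -map_comp; congr FMonom.
by rewrite -[RHS]map_id; apply: eq_map => -[i b] /=; rewrite negbK.
Qed.

Lemma word_starM v w :
  word_star (monalg.mul v w) = monalg.mul (word_star w) (word_star v).
Proof.
case: v w => [s] [t].
have E (a b : seq ('I_n * bool)) :
    monalg.mul (FMonom a) (FMonom b) = FMonom (a ++ b) :> word.
  by apply/eqP; rewrite -val_eqE; apply/eqP; exact: fmM.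
by rewrite E /word_star /= map_cat rev_cat E.
Qed.

End Words.

(* The free *-algebra on n generators is the free algebra on the letters
   (i, false), standing for the i-th generator x_i, and (i, true), standing for
   x_i^*. *)
Definition free_star_alg (C : numClosedFieldType) (n : nat) : Type :=
  malg (fmonom ('I_n * bool)%type) C.
HB.instance Definition _ (C : numClosedFieldType) (n : nat) :=
  GRing.Lmodule.on (free_star_alg C n).

(* These constants are locked because failing conversions between elements of
   malg do not terminate in practice. *)
HB.lock Definition free_gen (C : numClosedFieldType) (n : nat) (i : 'I_n) :
  free_star_alg C n := mkmalgU (FMonom [:: (i, false)]) 1.
HB.lock Definition free_one (C : numClosedFieldType) (n : nat) :
  free_star_alg C n := (1 : malg (fmonom ('I_n * bool)%type) C).
HB.lock Definition free_mul (C : numClosedFieldType) (n : nat)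
  (g h : malg (fmonom ('I_n * bool)%type) C) : free_star_alg C n := g * h.
HB.lock Definition free_star (C : numClosedFieldType) (n : nat)
  (g : malg (fmonom ('I_n * bool)%type) C) : free_star_alg C n :=
  malg_star (@word_star n) g.

Section FreeStarAlgebra.
Variables (C : numClosedFieldType) (n : nat).

Local Notation word := (fmonom ('I_n * bool)%type).
Local Notation F := (malg word C).
Local Notation one := (free_one C n).
Local Notation mul := (@free_mul C n).
Local Notation inv := (@free_star C n).

Fact free_mulA : associative mul.
Proof. by move=> f g h; rewrite !free_mul.unlock; exact: (@mulrA F). Qed.
Fact free_mul1 : left_id one mul.
Proof. by move=> g; rewrite free_mul.unlock free_one.unlock; exact: (@mul1r F). Qed.
Fact free_mulr1 : right_id one mul.
Proof. by move=> g; rewrite free_mul.unlock free_one.unlock; exact: (@mulr1 F). Qed.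
Fact free_mulDl : left_distributive mul +%R.
Proof. by move=> f g h; rewrite !free_mul.unlock; exact: (@mulrDl F). Qed.
Fact free_mulDr : right_distributive mul +%R.
Proof. by move=> f g h; rewrite !free_mul.unlock; exact: (@mulrDr F). Qed.
Fact free_mulZl (c : C) (g h : free_star_alg C n) :
  mul (c *: g) h = c *: mul g h.
Proof. by rewrite !free_mul.unlock; exact: (@malg_mulZl C word). Qed.
Fact free_mulZr (c : C) (g h : free_star_alg C n) :
  mul g (c *: h) = c *: mul g h.
Proof. by rewrite !free_mul.unlock; exact: (@malg_mulZr C word). Qed.
Fact free_starK : involutive inv.
Proof. by move=> g; rewrite !free_star.unlock; exact: malg_starK (@word_starK n) _. Qed.
Fact free_starD (g h : free_star_alg C n) : inv (g + h) = inv g + inv h.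
Proof. by rewrite !free_star.unlock; exact: malg_starD (@word_starK n) _ _. Qed.
Fact free_starZ (c : C) (g : free_star_alg C n) : inv (c *: g) = c^* *: inv g.
Proof. by rewrite !free_star.unlock; exact: malg_starZ (@word_starK n) _ _. Qed.
Fact free_starM (g h : free_star_alg C n) : inv (mul g h) = mul (inv h) (inv g).
Proof.
rewrite !free_star.unlock !free_mul.unlock.
exact: malg_starM (@word_starK n) (@word_starM n) _ _.
Qed.

HB.instance Definition _ := isStarAlgebra.Build C (free_star_alg C n)
  free_mulA free_mul1 free_mulr1 free_mulDl free_mulDr free_mulZl free_mulZr
  free_starK free_starD free_starZ free_starM.
End FreeStarAlgebra.

(* The two-sided *-ideal generated by S; it is closed under scalars because
   c *: a = (c *: sone) ** a. *)
Inductive star_ideal (C : numClosedFieldType) (A : starAlgType C) (S : set A) :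
    A -> Prop :=
| star_ideal_gen a : S a -> star_ideal S a
| star_ideal0 : star_ideal S 0
| star_idealD a b : star_ideal S a -> star_ideal S b -> star_ideal S (a + b)
| star_idealMl a b : star_ideal S b -> star_ideal S (a ** b)
| star_idealMr a b : star_ideal S a -> star_ideal S (a ** b)
| star_ideal_star a : star_ideal S a -> star_ideal S (star a).

Section StarQuotient.
Variables (C : numClosedFieldType) (A : starAlgType C) (S : set A).

Lemma star_idealZ (c : C) a : star_ideal S a -> star_ideal S (c *: a).
Proof. by move=> Sa; rewrite -[a]smul1 -smulZl; apply/star_idealMl. Qed.

Lemma star_idealN a : star_ideal S a -> star_ideal S (- a).
Proof. by rewrite -scaleN1r; exact: star_idealZ. Qed.

Definition star_equiv (a b : A) : bool := `[< star_ideal S (a - b) >].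

Lemma star_equiv_is_equiv : equiv_class_of star_equiv.
Proof.
split=> [a|a b|b a c].
- by apply/asboolP; rewrite subrr; exact: star_ideal0.
- by apply/asboolP/asboolP => /star_idealN; rewrite opprB.
- move=> /asboolP ab /asboolP bc; apply/asboolP.
  by rewrite -(subrK b a) -addrA; exact: star_idealD.
Qed.

Canonical star_equiv_equiv := EquivRelPack star_equiv_is_equiv.

Definition star_quot := {eq_quot star_equiv}.
Local Notation Q := star_quot.

HB.instance Definition _ := EqQuotient.on Q.
HB.instance Definition _ := Choice.on Q.

Definition star_proj (a : A) : Q := \pi a.

Lemma star_projP a b : star_proj a = star_proj b <-> star_ideal S (a - b).
Proof. by split=> [/eqmodP/asboolP|h] //; apply/eqmodP/asboolP. Qed.

Lemma star_projK (x : Q) : star_proj (repr x) = x.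
Proof. exact: reprK. Qed.

Lemma star_ind (P : Q -> Prop) : (forall a, P (star_proj a)) -> forall x, P x.
Proof. by move=> h x; rewrite -(star_projK x). Qed.

Definition quot_add (x y : Q) : Q := star_proj (repr x + repr y).
Definition quot_opp (x : Q) : Q := star_proj (- repr x).
Definition quot_mul (x y : Q) : Q := star_proj (repr x ** repr y).
Definition quot_scale (c : C) (x : Q) : Q := star_proj (c *: repr x).
Definition quot_star (x : Q) : Q := star_proj (star (repr x)).

Lemma quot_addE a b : quot_add (star_proj a) (star_proj b) = star_proj (a + b).
Proof.
apply/star_projP; rewrite opprD addrACA.
by apply: star_idealD; apply/star_projP; rewrite star_projK.
Qed.

Lemma quot_oppE a : quot_opp (star_proj a) = star_proj (- a).
Proof.
apply/star_projP; rewrite -opprD.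
by apply/star_idealN/star_projP; rewrite star_projK.
Qed.

Lemma quot_mulE a b : quot_mul (star_proj a) (star_proj b) = star_proj (a ** b).
Proof.
apply/star_projP; set a' := repr _; set b' := repr _.
have -> : a' ** b' - a ** b = (a' - a) ** b' + a ** (b' - b).
  rewrite smulDl smulDr -[- a]scaleN1r -[- b]scaleN1r smulZl smulZr !scaleN1r.
  by rewrite addrA subrK.
apply: star_idealD; [apply: star_idealMr|apply: star_idealMl];
  by apply/star_projP; rewrite star_projK.
Qed.

Lemma quot_scaleE c a : quot_scale c (star_proj a) = star_proj (c *: a).
Proof.
apply/star_projP; rewrite -scalerBr.
by apply/star_idealZ/star_projP; rewrite star_projK.
Qed.

Lemma quot_starE a : quot_star (star_proj a) = star_proj (star a).
Proof.
apply/star_projP.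
have -> : star (repr (star_proj a)) - star a = star (repr (star_proj a) - a).
  by rewrite starD -scaleN1r -[in RHS]scaleN1r starZ rmorphN1.
by apply/star_ideal_star/star_projP; rewrite star_projK.
Qed.

Let quotE := (quot_addE, quot_oppE, quot_mulE, quot_scaleE, quot_starE).

Fact quot_addA : associative quot_add.
Proof. by do 3!elim/star_ind=> ?; rewrite !quotE addrA. Qed.
Fact quot_addC : commutative quot_add.
Proof. by do 2!elim/star_ind=> ?; rewrite !quotE addrC. Qed.
Fact quot_add0 : left_id (star_proj 0) quot_add.
Proof. by elim/star_ind=> ?; rewrite !quotE add0r. Qed.
Fact quot_addN : left_inverse (star_proj 0) quot_opp quot_add.
Proof. by elim/star_ind=> ?; rewrite !quotE addNr. Qed.
HB.instance Definition _ :=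
  GRing.isZmodule.Build Q quot_addA quot_addC quot_add0 quot_addN.

Lemma star_projD a b : star_proj (a + b) = star_proj a + star_proj b.
Proof. by rewrite -quot_addE. Qed.

Fact quot_scaleA c d x : quot_scale c (quot_scale d x) = quot_scale (c * d) x.
Proof. by elim/star_ind: x => ?; rewrite !quotE scalerA. Qed.
Fact quot_scale1 : left_id 1 quot_scale.
Proof. by elim/star_ind=> ?; rewrite !quotE scale1r. Qed.
Fact quot_scaleDr : right_distributive quot_scale +%R.
Proof.
move=> c; do 2!elim/star_ind=> ?.
by rewrite -star_projD !quotE -star_projD scalerDr.
Qed.
Fact quot_scaleDl x : {morph quot_scale^~ x : c d / c + d}.
Proof. by elim/star_ind: x => ? c d; rewrite !quotE scalerDl star_projD. Qed.
HB.instance Definition _ := GRing.Zmodule_isLmodule.Build C Q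
  quot_scaleA quot_scale1 quot_scaleDr quot_scaleDl.

Lemma star_projZ c a : star_proj (c *: a) = c *: star_proj a.
Proof. by rewrite -quot_scaleE. Qed.

Fact quot_mulA : associative quot_mul.
Proof. by do 3!elim/star_ind=> ?; rewrite !quotE smulA. Qed.
Fact quot_mul1 : left_id (star_proj sone) quot_mul.
Proof. by elim/star_ind=> ?; rewrite !quotE smul1. Qed.
Fact quot_mulr1 : right_id (star_proj sone) quot_mul.
Proof. by elim/star_ind=> ?; rewrite !quotE smulr1. Qed.
Fact quot_mulDl : left_distributive quot_mul +%R.
Proof.
by do 3!elim/star_ind=> ?; rewrite -star_projD !quotE -star_projD smulDl.
Qed.
Fact quot_mulDr : right_distributive quot_mul +%R.
Proof.
by do 3!elim/star_ind=> ?; rewrite -star_projD !quotE -star_projD smulDr.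
Qed.
Fact quot_mulZl c (x y : Q) : quot_mul (c *: x) y = c *: quot_mul x y.
Proof.
elim/star_ind: x => a; elim/star_ind: y => b.
by rewrite -star_projZ !quotE -star_projZ smulZl.
Qed.
Fact quot_mulZr c (x y : Q) : quot_mul x (c *: y) = c *: quot_mul x y.
Proof.
elim/star_ind: x => a; elim/star_ind: y => b.
by rewrite -star_projZ !quotE -star_projZ smulZr.
Qed.
Fact quot_starK : involutive quot_star.
Proof. by elim/star_ind=> ?; rewrite !quotE starK. Qed.
Fact quot_starD (x y : Q) : quot_star (x + y) = quot_star x + quot_star y.
Proof.
elim/star_ind: x => a; elim/star_ind: y => b.
by rewrite -star_projD !quotE starD star_projD.
Qed.
Fact quot_starZ c (x : Q) : quot_star (c *: x) = c^* *: quot_star x.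
Proof.
by elim/star_ind: x => a; rewrite -star_projZ !quotE starZ star_projZ.
Qed.
Fact quot_starM x y :
  quot_star (quot_mul x y) = quot_mul (quot_star y) (quot_star x).
Proof.
by elim/star_ind: x => a; elim/star_ind: y => b; rewrite !quotE starM.
Qed.
HB.instance Definition _ := isStarAlgebra.Build C Q
  quot_mulA quot_mul1 quot_mulr1 quot_mulDl quot_mulDr quot_mulZl quot_mulZr
  quot_starK quot_starD quot_starZ quot_starM.

Lemma star_proj_is_star_hom : is_star_hom star_proj.
Proof.
split=> [a b|c a|a b||a] //.
- exact: star_projD.
- exact: star_projZ.
- by rewrite -quot_mulE.
- by rewrite -quot_starE.
Qed.

End StarQuotient.

Section Presentations.
Variable C : numClosedFieldType.

Section Sphere.
Variable q : C.

Local Notation A := (free_gen C (ord0 : 'I_2)).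
Local Notation B := (free_gen C (ord_max : 'I_2)).

Definition sphere_rel : set (free_star_alg C 2) :=
  [set star A - A;
       B ** A - q ^+ 2 *: (A ** B);
       star B ** B - (- (A ** A) + sone);
       B ** star B - (- (q ^+ 4 *: (A ** A)) + sone)].

Definition sphereA : star_quot sphere_rel := star_proj sphere_rel A.
Definition sphereB : star_quot sphere_rel := star_proj sphere_rel B.
End Sphere.

Section Disc.
Variable s : C.

Local Notation x := (free_gen C (ord0 : 'I_1)).

(* For real s the generator is self-adjoint, so the two-sided ideal it generates
   is a *-ideal. *)
Definition disc_rel : set (free_star_alg C 1) :=
  [set star x ** x - s *: (x ** star x) - (1 - s) *: sone].
End Disc.
End Presentations.

Notation PSphere q := (star_quot (sphere_rel q)).
Notation PDisc s := (star_quot (disc_rel s)).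

HB.mixin Record isHilbert (C : numClosedFieldType) H
    of CompleteNormedModule C H := {
  inner : H -> H -> C;
  innerD : forall x y z : H, inner (x + y) z = inner x z + inner y z;
  innerZ : forall (c : C) (x y : H), inner (c *: x) y = c * inner x y;
  innerC : forall x y : H, inner y x = (inner x y)^*;
  inner_norm : forall x : H, inner x x = `|x| ^+ 2
}.

#[short(type="hilbertType")]
HB.structure Definition Hilbert (C : numClosedFieldType) :=
  {H of CompleteNormedModule C H & isHilbert C H}.

HB.mixin Record isCStarAlgebra (C : numClosedFieldType) A
    of StarAlgebra C A & CompleteNormedModule C A := {
  cstar_normM : forall a b : A, `|a ** b| <= `|a| * `|b|;
  cstar_norm : forall a : A, `|star a ** a| = `|a| ^+ 2
}.

#[short(type="cstarAlgType")]
HB.structure Definition CStarAlgebra (C : numClosedFieldType) :=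
  {A of StarAlgebra C A & CompleteNormedModule C A & isCStarAlgebra C A}.

(* Unital *-representations by bounded operators; no continuity in a : A. *)
Record is_star_rep (C : numClosedFieldType) (A : starAlgType C)
    (H : hilbertType C) (pi : A -> H -> H) : Prop := IsStarRep {
  rep_linear : forall a, linear (pi a);
  rep_bounded : forall a, exists M : C, forall x, `|pi a x| <= M * `|x|;
  repD : forall a b x, pi (a + b) x = pi a x + pi b x;
  repZ : forall (c : C) a x, pi (c *: a) x = c *: pi a x;
  repM : forall a b x, pi (a ** b) x = pi a (pi b x);
  rep1 : forall x, pi sone x = x;
  rep_star : forall a x y, inner (pi a x) y = inner x (pi (star a) y)
}.

Definition orthonormal_basis (C : numClosedFieldType) (H : hilbertType C)
    (e : nat -> H) : Prop :=
  (forall j k, inner (e j) (e k) = (j == k)%:R) /\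
  closure [set x | exists (n : nat) (c : nat -> C), x = \sum_(k < n) c k *: e k]
    = [set: H].

(* iota exhibits B as the completion of A for the norm
   sup { |pi a| : pi a *-representation of A }, with |pi a| the operator norm. *)
Record is_cstar_closure (C : numClosedFieldType) (A : starAlgType C)
    (B : cstarAlgType C) (iota : A -> B) : Prop := IsCStarClosure {
  closure_hom : is_star_hom iota;
  closure_norm : forall a, supremums
    [set t : C | exists (H : hilbertType C) (pi : A -> H -> H) (x : H),
                   [/\ is_star_rep pi, `|x| <= 1 & t = `|pi a x|]]
    `|iota a|;
  closure_dense : closure (range iota) = [set: B]
}.

Section SphereRepresentations.
Variables (C : numClosedFieldType) (q : C).
Variables (CS : cstarAlgType C) (iota : PSphere q -> CS) (H : hilbertType C).

(* pi_+ for sgn = 1 and pi_- for sgn = -1. *)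
Record is_sphere_rep (e : nat -> H) (sgn : C) (pi : CS -> H -> H) : Prop :=
  IsSphereRep {
  sphere_rep : is_star_rep pi;
  sphere_repA : forall k,
    pi (iota (sphereA q)) (e k) = (sgn * q ^+ (2 * k)) *: e k;
  sphere_repB0 : pi (iota (sphereB q)) (e 0%N) = 0;
  sphere_repB : forall k, pi (iota (sphereB q)) (e k.+1) =
    sqrtC (1 - q ^+ (4 * k.+1)) *: e k
}.

Definition rep_sum (pip pim : CS -> H -> H) (a : CS) : (H -> H) * (H -> H) :=
  (pip a, pim a).

Definition flip (T : Type) (p : T * T) : T * T := (p.2, p.1).

(* pinv_ is the inverse of rep_sum on its range, rep_sum being injective. *)
Definition r1_bar (pip pim : CS -> H -> H) : CS -> CS :=
  pinv_ (fun=> 0) [set: CS] (rep_sum pip pim) \o @flip (H -> H)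
    \o rep_sum pip pim.

End SphereRepresentations.

(* R[i] as a numClosedFieldType. The canonical instance is named explicitly:
   R[i] itself would be elaborated to a reverse coercion, which gets in the way
   of unification. *)
Notation Cfield R := (complex_complex__canonical__Num_ClosedField R).

(* Main.v *)
Require Import Defs.
From mathcomp Require Import all_boot all_order all_algebra complex.
From mathcomp Require Import boolp classical_sets functions reals topology normedtype sequences.
From mathcomp Require Import zify ring lra.
From mathcomp Require Import finmap generic_quotient.
From mathcomp.multinomials Require monalg.
Import -(notations) monalg.

Set Implicit Arguments.
Unset Strict Implicit.
Unset Printing Implicit Defensive.
Import Order.TTheory GRing.Theory Num.Theory.
Import numFieldNormedType.Exports.
Local Open Scope ring_scope.
Local Open Scope classical_set_scope.

(** Put x = B^* and s = q^4. The relations of the sphere give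
x^* x - s x x^* = 1 - s, so x |-> B^* defines a *-homomorphism phi from P(D_s) to
P(S^2_q). Since A commutes with B and B^* up to scalars and A A = 1 - B^* B, every
element of P(S^2_q) has the form phi d0 + A phi d1. As r_1 changes the sign of the
second term, the r_1-invariants are exactly the range of phi (r1_fixed).

On the completions, phi and r_1 extend to F : C(D_s) -> C(S^2_q) and to rbar
(closure_extend_hom). Averaging shows that the fixed points of rbar form the
closure of the r_1-invariants, and this closure is the range of F provided that F is
bounded below. Moreover rbar exchanges pi_+ and pi_-, so it is the automorphism of
the statement provided that pi_+ and pi_- are jointly faithful. Both provisos follow
from one estimate, disc_fock_bound: |c| <= 2 |pi_+ (F c)| for c in C(D_s), that is,
the Fock representation of the disc is faithful. For the second one, if pi_+ and pi_-
kill a, then b = a^* a + rbar (a^* a) is invariant, hence of the form F c, and it is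
killed by pi_+; so b = 0, and a = 0 because |a|^2 <= |b| by positivity
(rep_pair_faithful).

It remains to bound an arbitrary representation pi of P(D_s), on K, by the Fock
representation rho, on H. Let T be the image of x and D = 1 - T T^*. Then
T^* T = 1 - s D is invertible, and T = V^* h with V V^* = 1 (disc_polar). By the
Wold decomposition K is the sum of a multiple of the Fock representation and of a
part on which V is unitary. Rather than splitting K, a vector v is sent to the
tensor product of H and K by the two maps v |-> sum_(k < N) e_k (x) P V^k v, with P = 1 - V^* V, and
v |-> N^(-1/2) sum_(k < N) e_k (x) V^k v. Their squared norms add up to a number
between |v|^2 and 2 |v|^2, because |P V^k v|^2 = |V^k v|^2 - |V^(k+1) v|^2. When N
grows they intertwine pi T with rho T, because P V^k h is the k-th Fock weight times
P V^k, while V^k h is close to V^k and the Fock weights are close to 1. Comparing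
norms bounds |pi p| by 2 |rho p| for every p (toeplitz_domination). *)

(** * Real-valued norms, fixed points and extension by continuity *)

Section RealNorm.
Variable R : realType.
Local Notation C := (Cfield R).

Definition cabs (c : C) : R := complex.Re (`|c| : C).

Lemma cabsE (c : C) : `|c| = ((cabs c)%:C)%C.
Proof. by rewrite /cabs RRe_real // normr_real. Qed.

Lemma cabs_ge0 (c : C) : 0 <= cabs c.
Proof. by rewrite -lecR -cabsE normr_ge0. Qed.

Lemma cabs_real (a : R) : cabs ((a%:C)%C : C) = `|a|.
Proof. by apply: complexI; rewrite -cabsE normc_def /= expr0n addr0 sqrtr_sqr. Qed.

Lemma cabs2 (c : C) : (((cabs c) ^+ 2)%:C)%C = c * c^* :> C.
Proof. by rewrite rmorphXn /= -cabsE normCK. Qed.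

Lemma cabsM (c d : C) : cabs (c * d) = cabs c * cabs d.
Proof. by apply: complexI; rewrite rmorphM /= -!cabsE normrM. Qed.

Lemma conjC_real (a : R) : ((a%:C)%C : C)^* = (a%:C)%C.
Proof. exact: conjc_real. Qed.

Section Normed.
Variable V : normedModType C.
Implicit Types x y : V.

(** The norms of the spaces at hand take values in the complex numbers, whose
order is only partial; their real values live in an ordered field. *)
Definition rnorm x : R := complex.Re (`|x| : C).

Lemma rnormE x : `|x| = ((rnorm x)%:C)%C.
Proof. by rewrite /rnorm RRe_real // normr_real. Qed.

Lemma rnorm_ge0 x : 0 <= rnorm x.
Proof. by rewrite -lecR -rnormE normr_ge0. Qed.

Lemma rnorm_le x (M : R) : (`|x| <= (M%:C)%C) = (rnorm x <= M).
Proof. by rewrite rnormE lecR. Qed.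

Lemma rnorm_lt x (M : R) : (`|x| < (M%:C)%C) = (rnorm x < M).
Proof. by rewrite rnormE ltcR. Qed.

Lemma rnormD x y : rnorm (x + y) <= rnorm x + rnorm y.
Proof. by rewrite -lecR rmorphD /= -!rnormE ler_normD. Qed.

Lemma rnormN x : rnorm (- x) = rnorm x.
Proof. by rewrite /rnorm normrN. Qed.

Lemma rnormB x y : rnorm (x - y) <= rnorm x + rnorm y.
Proof. by rewrite -(rnormN y) rnormD. Qed.

Lemma rdistC x y : rnorm (x - y) = rnorm (y - x).
Proof. by rewrite -opprB rnormN. Qed.

Lemma rdistD y x z : rnorm (x - z) <= rnorm (x - y) + rnorm (y - z).
Proof. by rewrite -[x - z](subrKA y) rnormD. Qed.

Lemma rnorm0 : rnorm 0 = 0.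
Proof. by rewrite /rnorm normr0. Qed.

Lemma rnorm0_eq0 x : rnorm x = 0 -> x = 0.
Proof. by move=> x0; apply/normr0_eq0; rewrite rnormE x0. Qed.

Lemma rnormZ c x : rnorm (c *: x) = cabs c * rnorm x.
Proof. by apply: complexI; rewrite rmorphM /= -!rnormE -cabsE normrZ. Qed.

Lemma rnormZr (a : R) x : rnorm ((a%:C)%C *: x) = `|a| * rnorm x.
Proof. by rewrite rnormZ cabs_real. Qed.

Lemma rnorm_small x : (forall e : R, 0 < e -> rnorm x <= e) -> x = 0.
Proof.
move=> h; apply: rnorm0_eq0; apply/eqP; rewrite eq_le rnorm_ge0 andbT.
by apply/ler_addgt0Pr => e e0; rewrite add0r h.
Qed.

Lemma closure_rnormP (S : set V) x :
  closure S x <-> forall e : R, 0 < e -> exists2 y, S y & rnorm (x - y) < e.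
Proof.
split=> [Sx e e0|h B /nbhs_ballP[e e0 eB]].
  have [|y [Sy]] := Sx (ball x ((e%:C)%C : C)).
    by apply: nbhsx_ballx; rewrite ltcR.
  by rewrite -ball_normE /= rnorm_lt; exists y.
have eR : e = ((complex.Re e)%:C)%C by rewrite RRe_real // gtr0_real.
rewrite eR /= ltcR in e0 eB.
have [y Sy xy] := h _ e0.
by exists y; split=> //; apply: eB; rewrite -ball_normE /= rnorm_lt.
Qed.

Lemma closed_ball_lim (l : V) (M : R) :
  (forall e : R, 0 < e -> exists2 y, rnorm y <= M & rnorm (l - y) < e) ->
  rnorm l <= M.
Proof.
move=> h; apply/ler_addgt0Pr => e e0; have [y yM ly] := h e e0.
by rewrite -[l](subrK y) (le_trans (rnormD _ _)) // addrC lerD // ltW.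
Qed.
End Normed.

Section Complete.
Variable V : completeNormedModType C.

Lemma expr_small (r e : R) : 0 <= r < 1 -> 0 < e ->
  exists N, forall n, (N <= n)%N -> r ^+ n < e.
Proof.
move=> /andP[r0 r1] e0.
have /cvgrPdist_lt /(_ _ e0) [N _ h] : (fun n => r ^+ n) @ \oo --> (0 : R).
  by apply: cvg_expr; rewrite ger0_norm.
by exists N => n Nn; have := h n Nn; rewrite /= sub0r normrN ger0_norm ?exprn_ge0.
Qed.

Lemma geometric_cauchy (u : nat -> V) (r M : R) : 0 <= r < 1 ->
  (forall n, rnorm (u n.+1 - u n) <= M * r ^+ n) ->
  exists l, forall n, rnorm (u n - l) <= M / (1 - r) * r ^+ n.
Proof.
move=> /andP[r0 r1] du.
have M0 : 0 <= M by have := du 0%N; rewrite expr0 mulr1; apply/le_trans/rnorm_ge0.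
have r1' : 0 < 1 - r by rewrite subr_gt0.
have tele n m : rnorm (u n - u (n + m)%N) <= M / (1 - r) * (r ^+ n - r ^+ (n + m)).
  elim: m => [|m IH]; first by rewrite addn0 !subrr mulr0 rnorm0.
  rewrite addnS (le_trans (rdistD (u (n + m)%N) _ _)) //.
  rewrite [in X in _ + X]rdistC (le_trans (lerD IH (du _))) // exprS.
  suff -> : M * r ^+ (n + m) = M / (1 - r) * (r ^+ (n + m) - r * r ^+ (n + m)).
    by rewrite -mulrDr addrA subrK.
  by rewrite -[X in X - r * _]mul1r -mulrBl mulrA divfK // gt_eqF.
have dist n m : rnorm (u n - u (n + m)%N) <= M / (1 - r) * r ^+ n.
  apply: (le_trans (tele n m)); apply: ler_wpM2l; first by rewrite divr_ge0 // ltW.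
  by rewrite gerBl exprn_ge0.
have : cvgn u.
  apply/cauchy_cvgP; apply/cauchy_exP => e e0.
  have eR : e = ((complex.Re e)%:C)%C by rewrite RRe_real // gtr0_real.
  rewrite eR in e0 *; rewrite ltcR in e0.
  have [N h] : exists N, forall n, (N <= n)%N -> r ^+ n < complex.Re e / (1 + M / (1 - r)).
    apply: expr_small; first by rewrite r0.
    by rewrite divr_gt0 // ltr_pwDl // divr_ge0 // ltW.
  exists (u N), N => // n /= Nn.
  rewrite -ball_normE /= rnorm_lt -(subnKC Nn).
  apply: (le_lt_trans (dist _ _)).
  have := h N (leqnn _); rewrite ltr_pdivlMr; last by rewrite ltr_pwDl // divr_ge0 // ltW.
  by apply/le_lt_trans; rewrite mulrC ler_wpM2l ?exprn_ge0 // lerDr.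
move=> ucv; exists (limn u) => n; apply/ler_addgt0Pr => e e0.
have /cvgrPdist_lt /(_ (e%:C)%C) := ucv; rewrite ltcR => /(_ e0) [N _ h].
have := h (n + N)%N (leq_addl _ _); rewrite /= rnorm_lt rdistC => lN.
by rewrite (le_trans (rdistD (u (n + N)%N) _ _)) // lerD // ltW.
Qed.

(** Banach's fixed point theorem on a ball; it provides square roots and inverses
in C*-algebras. *)
Lemma contraction_fixpoint (f : V -> V) (r rho : R) : 0 <= r < 1 -> 0 <= rho ->
  (forall x, rnorm x <= rho -> rnorm (f x) <= rho) ->
  (forall x y, rnorm x <= rho -> rnorm y <= rho ->
    rnorm (f x - f y) <= r * rnorm (x - y)) ->
  exists2 x, rnorm x <= rho & f x = x.
Proof.
move=> r01 rho0 fB fr; pose u n := iter n f 0.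
have uB n : rnorm (u n) <= rho.
  by elim: n => [|n IH]; rewrite /u ?rnorm0 //= fB.
have du n : rnorm (u n.+1 - u n) <= rnorm (u 1%N) * r ^+ n.
  elim: n => [|n IH]; first by rewrite subr0 expr0 mulr1.
  rewrite -/(u n.+1) -/(u n).
  change (rnorm (f (u n.+1) - f (u n)) <= rnorm (u 1%N) * r ^+ n.+1).
  rewrite (le_trans (fr _ _ (uB _) (uB _))) // exprS mulrCA.
  by case/andP: r01 => r0 _; rewrite ler_wpM2l.
have [l lu] := geometric_cauchy r01 du.
have ul e : 0 < e -> exists n, rnorm (u n - l) < e /\ rnorm (u n.+1 - l) < e.
  move=> e0; set D := rnorm (u 1%N) / (1 - r) in lu.
  have D0 : 0 <= D by rewrite divr_ge0 ?rnorm_ge0 // subr_ge0 ltW //; case/andP: r01.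
  have [|N h] := expr_small r01 (e := e / (1 + D)); first by rewrite divr_gt0 // ltr_pwDl.
  have g n : (N <= n)%N -> rnorm (u n - l) < e.
    move=> /h; rewrite ltr_pdivlMr ?ltr_pwDl // => {}h.
    apply: (le_lt_trans (lu n)); apply/le_lt_trans: h.
    by rewrite mulrC ler_wpM2l ?lerDr // exprn_ge0 //; case/andP: r01.
  by exists N; split; apply: g.
have lB : rnorm l <= rho.
  by apply: closed_ball_lim => e /ul[n [h _]]; exists (u n); rewrite // rdistC.
exists l => //; apply/eqP; rewrite -subr_eq0; apply/eqP/rnorm_small => e e0.
have [n [h1 h2]] := ul (e / 2) (divr_gt0 e0 (ltr0Sn _ 1)).
rewrite (le_trans (rdistD (u n.+1) _ _)) // [e]splitr lerD ?ltW // rdistC.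
apply: le_lt_trans h1; change (rnorm (f (u n) - f l) <= rnorm (u n - l)).
rewrite (le_trans (fr _ _ (uB _) lB)) //.
by rewrite ler_piMl ?rnorm_ge0 // ltW //; case/andP: r01.
Qed.
End Complete.

(** The value at b is the only z such that |z - g a| <= M |b - i a| for all a;
with this description, identities satisfied by g pass to G by approximation. *)
Lemma bounded_extension (A : lmodType C) (B : normedModType C)
    (Z : completeNormedModType C) (i : A -> B) (g : A -> Z) (M : R) :
  0 <= M ->
  (forall a b, i (a + b) = i a + i b) -> (forall (c : C) a, i (c *: a) = c *: i a) ->
  (forall a b, g (a + b) = g a + g b) -> (forall (c : C) a, g (c *: a) = c *: g a) ->
  closure (range i) = [set: B] -> (forall a, rnorm (g a) <= M * rnorm (i a)) ->
  exists G : B -> Z, forall b a, rnorm (G b - g a) <= M * rnorm (b - i a).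
Proof.
move=> M0 iD iZ gD gZ dense gM.
have subE (W : lmodType C) (h : A -> W) : (forall a b, h (a + b) = h a + h b) ->
    (forall (c : C) a, h (c *: a) = c *: h a) -> forall a b, h (a - b) = h a - h b.
  by move=> hD hZ a b; rewrite -scaleN1r hD hZ scaleN1r.
have iB := subE _ i iD iZ; have gB := subE _ g gD gZ.
suff /choice[G hG] : forall b, exists z, forall a, rnorm (z - g a) <= M * rnorm (b - i a).
  by exists G.
move=> b.
have half0 : 0 < (2^-1 : R) by rewrite invr_gt0.
have /choice[a ha] (n : nat) : exists a, rnorm (b - i a) < (2^-1 : R) ^+ n.
  have : closure (range i) b by rewrite dense.
  by move=> /closure_rnormP /(_ _ (exprn_gt0 n half0))[_ [a _ <-] h]; exists a.
have half : 0 <= (2^-1 : R) < 1 by rewrite invr_ge0 ler0n invf_lt1 // ltr1n.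
have step n : rnorm (g (a n.+1) - g (a n)) <= (M * 2) * (2^-1 : R) ^+ n.
  rewrite -gB (le_trans (gM _)) // -mulrA ler_wpM2l // iB.
  rewrite (le_trans (rdistD b _ _)) // rdistC mulr_natl mulr2n lerD // ltW //.
  by rewrite (lt_le_trans (ha _)) // exprS ler_piMl // ?exprn_ge0 //; case/andP: half => // _ /ltW.
have [z hz] := geometric_cauchy half step; exists z => c.
apply/ler_addgt0Pr => e e0.
set D := M * 2 / (1 - 2^-1) in hz.
have D0 : 0 <= D by rewrite divr_ge0 ?mulr_ge0 // subr_ge0; case/andP: half => _ /ltW.
have [|N h] := expr_small half (e := e / (1 + D + M)).
  by rewrite divr_gt0 // ltr_pwDl // ltr_pwDl.
have {h} := h N (leqnn N); rewrite ltr_pdivlMr; last by rewrite ltr_pwDl // ltr_pwDl.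
rewrite 2!mulrDr mulr1 => ht.
have t0 : 0 <= (2^-1 : R) ^+ N by rewrite exprn_ge0 //; case/andP: half.
have h1 := hz N; rewrite rdistC in h1.
have h2 := ler_wpM2l M0 (rdistD b (i (a N)) (i c)).
rewrite mulrDr [X in _ <= M * X + _]rdistC in h2.
have h3 := ler_wpM2l M0 (ltW (ha N)); have h4 := gM (a N - c); rewrite gB iB in h4.
have h5 := rdistD (g (a N)) z (g c).
rewrite [_ * M]mulrC [_ * D]mulrC in ht.
apply: (le_trans h5); apply: (le_trans (lerD h1 (le_trans h4 h2))).
move: ht h3; move: (_ ^+ N) (rnorm _) (rnorm _) t0 => t x y t0 ht h3; lra.
Qed.
End RealNorm.

(** Since F is bounded below, it reflects Cauchy sequences. *)
Lemma closed_range (R : realType) (V : completeNormedModType (Cfield R))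
    (W : normedModType (Cfield R)) (F : V -> W) (M : R) :
  0 <= M -> (forall x y, F (x - y) = F x - F y) ->
  (forall x, rnorm (F x) <= rnorm x) -> (forall x, rnorm x <= M * rnorm (F x)) ->
  forall b, closure (range F) b -> exists a, F a = b.
Proof.
move=> M0 FB F1 FM b hb.
have half : 0 <= (2^-1 : R) < 1 by rewrite invr_ge0 ler0n invf_lt1 // ltr1n.
have half0 : 0 < (2^-1 : R) by rewrite invr_gt0.
have /choice[c hc] (n : nat) : exists a, rnorm (b - F a) < (2^-1 : R) ^+ n.
  by move/closure_rnormP: hb => /(_ _ (exprn_gt0 n half0)) [_ [a _ <-] h]; exists a.
have [n|l hl] := @geometric_cauchy _ V c _ (M * 2) half.
  rewrite (le_trans (FM _)) // -mulrA ler_wpM2l // FB.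
  rewrite (le_trans (rdistD b _ _)) // rdistC mulr_natl mulr2n.
  apply: lerD; last exact: ltW.
  apply/ltW/(lt_le_trans (hc _)); rewrite exprS.
  by apply: ler_piMl; [exact/exprn_ge0/ltW|case/andP: half => _ /ltW].
exists l; apply/eqP; rewrite -subr_eq0; apply/eqP/rnorm_small => eps e0.
set D := M * 2 / (1 - 2^-1) in hl.
have D0 : 0 <= D.
  by rewrite divr_ge0 ?mulr_ge0 // subr_ge0; case/andP: half => _ /ltW.
have [|N h] := expr_small half (e := eps / (1 + D)).
  by rewrite divr_gt0 // ltr_pwDl.
have {h} := h N (leqnn N); rewrite ltr_pdivlMr ?ltr_pwDl // mulrDr mulr1 => h.
have h1 := hc N; have h2 := hl N; have h3 := F1 (c N - l); rewrite FB in h3.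
have h4 := rdistD (F (c N)) (F l) b.
rewrite (rdistC (F l) (F (c N))) (rdistC (F (c N)) b) in h4.
apply: (le_trans h4); apply: (le_trans (lerD (le_trans h3 h2) (ltW h1))).
by rewrite [D * _]mulrC addrC ltW.
Qed.

Lemma sqrtC_of_real (R : realType) (a : R) : 0 <= a ->
  sqrtC ((a%:C)%C : Cfield R) = ((Num.sqrt a)%:C)%C.
Proof.
move=> a0; rewrite -{1}(sqr_sqrtr a0) rmorphXn /= sqrCK //.
by rewrite ler0c sqrtr_ge0.
Qed.

(** * C*-algebras: adjoints, square roots and inverses *)

Section StarAlgebraTheory.
Variables (C : numClosedFieldType) (A : starAlgType C).
Implicit Types a b : A.

Lemma smulNl a b : (- a) ** b = - (a ** b).
Proof. by rewrite -scaleN1r smulZl scaleN1r. Qed.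
Lemma smulNr a b : a ** (- b) = - (a ** b).
Proof. by rewrite -scaleN1r smulZr scaleN1r. Qed.
Lemma smulBl a b c : (a - b) ** c = a ** c - b ** c.
Proof. by rewrite smulDl smulNl. Qed.
Lemma smulBr a b c : a ** (b - c) = a ** b - a ** c.
Proof. by rewrite smulDr smulNr. Qed.
Lemma smul0l a : 0 ** a = 0.
Proof. by apply: (addrI (0 ** a)); rewrite -smulDl !addr0. Qed.
Lemma smul0r a : a ** 0 = 0.
Proof. by apply: (addrI (a ** 0)); rewrite -smulDr !addr0. Qed.
Lemma star0 : star 0 = 0 :> A.
Proof. by apply: (addrI (star 0)); rewrite -starD !addr0. Qed.
Lemma starN a : star (- a) = - star a.
Proof. by rewrite -scaleN1r starZ rmorphN1 scaleN1r. Qed.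
Lemma starB a b : star (a - b) = star a - star b.
Proof. by rewrite starD starN. Qed.
Lemma star1 : star sone = sone :> A.
Proof. by rewrite -[LHS]smul1 -[X in X ** _]starK -starM smul1 starK. Qed.
End StarAlgebraTheory.

Section StarHomTheory.
Variables (C : numClosedFieldType) (A B D : starAlgType C).

Lemma star_hom0 (f : A -> B) : is_star_hom f -> f 0 = 0.
Proof. by move=> hf; apply: (addrI (f 0)); rewrite -(star_homD hf) !addr0. Qed.
Lemma star_homB (f : A -> B) a b : is_star_hom f -> f (a - b) = f a - f b.
Proof. by move=> hf; rewrite (star_homD hf) -scaleN1r (star_homZ hf) scaleN1r. Qed.
Lemma star_homN (f : A -> B) a : is_star_hom f -> f (- a) = - f a.
Proof. by move=> hf; rewrite -scaleN1r (star_homZ hf) scaleN1r. Qed.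
Lemma star_hom_comp (f : A -> B) (g : B -> D) :
  is_star_hom f -> is_star_hom g -> is_star_hom (g \o f).
Proof.
move=> hf hg; split=> [a b|c a|a b||a] /=.
- by rewrite (star_homD hf) (star_homD hg).
- by rewrite (star_homZ hf) (star_homZ hg).
- by rewrite (star_homM hf) (star_homM hg).
- by rewrite (star_hom1 hf) (star_hom1 hg).
- by rewrite (star_hom_star hf) (star_hom_star hg).
Qed.

Lemma star_rep_comp (H : hilbertType C) (f : A -> B) (pi : B -> H -> H) :
  is_star_hom f -> is_star_rep pi -> is_star_rep (pi \o f).
Proof.
move=> hf hp; split=> /= [a|a|a b x|c a x|a b x|x|a x y].
- exact: rep_linear hp _.
- exact: rep_bounded hp _.
- by rewrite (star_homD hf) (repD hp).
- by rewrite (star_homZ hf) (repZ hp).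
- by rewrite (star_homM hf) (repM hp).
- by rewrite (star_hom1 hf) (rep1 hp).
- by rewrite (star_hom_star hf) (rep_star hp).
Qed.
End StarHomTheory.

Section CStarAlgebraTheory.
Variables (R : realType).
Local Notation C := (Cfield R).
Variable A : cstarAlgType C.
Implicit Types a b X Y : A.

Lemma rnormM a b : rnorm (a ** b) <= rnorm a * rnorm b.
Proof. by rewrite -lecR rmorphM /= -!rnormE cstar_normM. Qed.

Lemma rnorm_cstar a : rnorm (star a ** a) = rnorm a ^+ 2.
Proof. by apply: complexI; rewrite rmorphXn /= -!rnormE cstar_norm. Qed.

Lemma rnorm_star a : rnorm (star a) = rnorm a.
Proof.
have le b : rnorm b <= rnorm (star b).
  have := rnormM (star b) b; rewrite rnorm_cstar expr2.
  have [->|b0] := eqVneq (rnorm b) 0; first by rewrite rnorm_ge0.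
  by rewrite ler_pM2r // lt_def b0 rnorm_ge0.
by apply/eqP; rewrite eq_le le -{2}[a]starK le.
Qed.

Lemma rnorm1_le : rnorm (sone : A) <= 1.
Proof.
have := rnorm_cstar sone; rewrite star1 smul1.
have := rnorm_ge0 (sone : A); move: (rnorm _) => x x0 h.
have [->|xn0] := eqVneq x 0; first exact: ler01.
by rewrite -(@ler_pM2r _ x) ?lt_def ?xn0 // mul1r -expr2 -h.
Qed.

(** The map y |-> (X + y y) / 2 is a contraction of the ball of radius r, and its
fixed point satisfies (1 - Y)^2 = 1 - X: this is the square root that is needed
instead of a functional calculus. By uniqueness Y is self-adjoint. *)
Lemma cstar_sqrt X (r : R) : 0 <= r < 1 -> rnorm X <= r -> star X = X ->
  exists Y, [/\ rnorm Y <= r, star Y = Y & Y + Y = X + Y ** Y].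
Proof.
move=> r01 Xr sX; have /andP[r0 r1] := r01.
pose h : R := 2^-1; have h0 : 0 <= h by rewrite invr_ge0.
pose f y : A := (h%:C)%C *: (X + y ** y).
have fN x : rnorm (f x) = h * rnorm (X + x ** x) by rewrite rnormZr ger0_norm.
have f2 y : f y + f y = X + y ** y.
  have hh : h + h = 1 by rewrite /h; lra.
  by rewrite /f -scalerDl -rmorphD /= hh scale1r.
have fB x y : rnorm x <= r -> rnorm y <= r -> rnorm (f x - f y) <= r * rnorm (x - y).
  move=> xr yr.
  have -> : f x - f y = (h%:C)%C *: (x ** (x - y) + (x - y) ** y).
    by rewrite /f -scalerBr smulBr smulBl addrA subrK opprD addrACA subrr add0r.
  rewrite rnormZr ger0_norm //; set d := rnorm (x - y).
  have d0 : 0 <= d by apply: rnorm_ge0.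
  have h1 : rnorm (x ** (x - y)) <= r * d by rewrite (le_trans (rnormM _ _)) // ler_wpM2r.
  have h2 : rnorm ((x - y) ** y) <= r * d.
    by rewrite (le_trans (rnormM _ _)) // mulrC ler_wpM2r.
  have := rnormD (x ** (x - y)) ((x - y) ** y); rewrite /h => h3; lra.
have [|Y Yr fY] := contraction_fixpoint r01 r0 (f := f) _ fB.
  move=> x xr; rewrite fN.
  have h1 : rnorm (x ** x) <= r.
    rewrite (le_trans (rnormM _ _)) // (le_trans (ler_pM _ _ xr xr)) ?rnorm_ge0 //.
    by rewrite ler_piMl // ltW.
  have := rnormD X (x ** x); rewrite /h => h3; lra.
exists Y; split=> //; last by rewrite -{1 2}fY f2.
have fsY : f (star Y) = star Y.
  by rewrite -{2}fY /f starZ conjC_real starD sX starM.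
apply/eqP; rewrite -subr_eq0; apply/eqP/rnorm0_eq0/eqP.
have : rnorm (star Y - Y) <= r * rnorm (star Y - Y).
  by have := fB (star Y) Y; rewrite fsY fY rnorm_star; apply.
have := rnorm_ge0 (star Y - Y); move: (rnorm _) => d d0 dr.
by rewrite eq_le d0 andbT; nra.
Qed.

(** The Neumann series of Y, as the fixed point of z |-> 1 + Y z. *)
Lemma cstar_inv Y (r : R) : 0 <= r < 1 -> rnorm Y <= r -> star Y = Y ->
  exists Z, [/\ star Z = Z, (sone - Y) ** Z = sone & Z ** (sone - Y) = sone].
Proof.
move=> r01 Yr sY; have /andP[r0 r1] := r01.
have r1' : 0 < 1 - r by rewrite subr_gt0.
pose f z : A := sone + Y ** z.
have [|||Z _ fZ] := contraction_fixpoint (f := f) (rho := (1 - r)^-1) r01.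
- by rewrite invr_ge0 ltW.
- move=> x xr; rewrite (le_trans (rnormD _ _)) //.
  have -> : (1 - r)^-1 = 1 + r * (1 - r)^-1.
    by field; rewrite gt_eqF.
  by rewrite lerD ?rnorm1_le // (le_trans (rnormM _ _)) // ler_pM ?rnorm_ge0.
- move=> x y _ _; rewrite /f opprD addrACA subrr add0r -smulBr.
  by rewrite (le_trans (rnormM _ _)) // ler_wpM2r ?rnorm_ge0.
have Zr : (sone - Y) ** Z = sone.
  by apply/eqP; rewrite smulBl smul1 subr_eq -/(f Z) fZ eqxx.
have Zl : star Z ** (sone - Y) = sone.
  by have := congr1 star Zr; rewrite starM starB star1 sY.
have sZ : star Z = Z by rewrite -[LHS]smulr1 -Zr smulA Zl smul1.
by exists Z; rewrite sZ in Zl.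
Qed.
End CStarAlgebraTheory.

(** * Hilbert spaces and representations *)

Section Hilbert.
Variables (R : realType).
Local Notation C := (Cfield R).
Variable H : hilbertType C.
Implicit Types x y z w : H.

Lemma inner_rnorm x : inner x x = (((rnorm x) ^+ 2)%:C)%C :> C.
Proof. by rewrite inner_norm rnormE rmorphXn. Qed.

Lemma innerDr x y z : inner x (y + z) = inner x y + inner x z.
Proof. by rewrite innerC innerD rmorphD /= -!innerC. Qed.

Lemma innerZr (c : C) x y : inner x (c *: y) = c^* * inner x y.
Proof. by rewrite innerC innerZ rmorphM /= -innerC. Qed.

Lemma innerNl x y : inner (- x) y = - inner x y.
Proof. by rewrite -scaleN1r innerZ mulN1r. Qed.

Lemma innerBl x y z : inner (x - y) z = inner x z - inner y z.
Proof. by rewrite innerD innerNl. Qed.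

Lemma inner0l x : inner 0 x = 0.
Proof. by rewrite -(subrr x) innerBl subrr. Qed.

Lemma inner0r x : inner x 0 = 0.
Proof. by rewrite innerC inner0l conjC0. Qed.

Lemma inner_suml n (f : nat -> H) y :
  inner (\sum_(k < n) f k) y = \sum_(k < n) inner (f k) y.
Proof.
elim: n => [|n IH]; first by rewrite !big_ord0 inner0l.
by rewrite !big_ord_recr /= innerD IH.
Qed.

Lemma inner_sumr n (f : nat -> H) y :
  inner y (\sum_(k < n) f k) = \sum_(k < n) inner y (f k).
Proof.
elim: n => [|n IH]; first by rewrite !big_ord0 inner0r.
by rewrite !big_ord_recr /= innerDr IH.
Qed.

Lemma inner_inj x y : (forall z, inner x z = inner y z) -> x = y.
Proof.
move=> h; apply/eqP; rewrite -subr_eq0; apply/eqP/rnorm0_eq0/eqP.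
rewrite -sqrf_eq0; apply/eqP/complexI; rewrite -inner_rnorm.
by rewrite innerBl h subrr.
Qed.

Lemma pythagoras x y : inner x y = 0 ->
  rnorm (x + y) ^+ 2 = rnorm x ^+ 2 + rnorm y ^+ 2.
Proof.
move=> xy; apply: complexI; rewrite rmorphD /= -!inner_rnorm innerD !innerDr xy.
by rewrite (innerC x y) xy conjC0 addr0 add0r.
Qed.

Definition orthonormal (r : nat) (u : nat -> H) :=
  forall i j, (i < r)%N -> (j < r)%N -> inner (u i) (u j) = (i == j)%:R.

Definition oproj (r : nat) (u : nat -> H) w := \sum_(i < r) inner w (u i) *: u i.

Lemma inner_orthonormal_sum r u (c : nat -> C) j : orthonormal r u -> (j < r)%N ->
  inner (\sum_(i < r) c i *: u i) (u j) = c j.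
Proof.
move=> ou jr; rewrite (inner_suml _ (fun i => c i *: u i)).
rewrite (bigD1 (Ordinal jr)) //= innerZ ou // eqxx mulr1 big1 ?addr0 // => i ij.
by rewrite innerZ ou // -(inj_eq val_inj) /= in ij *; rewrite (negPf ij) mulr0.
Qed.

Lemma rnorm_orthonormal_sum r u (c : nat -> C) : orthonormal r u ->
  rnorm (\sum_(i < r) c i *: u i) ^+ 2 = \sum_(i < r) cabs (c i) ^+ 2.
Proof.
move=> ou; apply: complexI; rewrite -inner_rnorm rmorph_sum /=.
rewrite (inner_sumr _ (fun i => c i *: u i)); apply: eq_bigr => i _.
by rewrite innerZr inner_orthonormal_sum // cabs2 mulrC.
Qed.

Lemma oproj_orth r u w j : orthonormal r u -> (j < r)%N ->
  inner (w - oproj r u w) (u j) = 0.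
Proof.
move=> ou jr; rewrite innerBl /oproj.
by rewrite (inner_orthonormal_sum (fun i => inner w (u i))) // subrr.
Qed.

Lemma bessel r u w : orthonormal r u ->
  \sum_(i < r) cabs (inner w (u i)) ^+ 2 <= rnorm w ^+ 2.
Proof.
move=> ou; rewrite -(rnorm_orthonormal_sum (fun i => inner w (u i)) ou).
have h : inner (w - oproj r u w) (oproj r u w) = 0.
  rewrite {2}/oproj (inner_sumr _ (fun i => inner w (u i) *: u i)) big1 // => i _.
  by rewrite innerZr oproj_orth // mulr0.
by rewrite -{2}[w](subrK (oproj r u w)) pythagoras // lerDr sqr_ge0.
Qed.

Lemma bessel_eq r u w : orthonormal r u -> w = oproj r u w ->
  \sum_(i < r) cabs (inner w (u i)) ^+ 2 = rnorm w ^+ 2.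
Proof.
move=> ou {2}->.
by rewrite -(rnorm_orthonormal_sum (fun i => inner w (u i)) ou).
Qed.

Lemma normalized x : x != 0 -> rnorm (((rnorm x)^-1%:C)%C *: x) = 1.
Proof.
move=> x0; rewrite rnormZr ger0_norm ?invr_ge0 ?rnorm_ge0 // mulVf //.
by apply: contra_neq x0; apply: rnorm0_eq0.
Qed.

Lemma cauchy_schwarz x y : cabs (inner x y) <= rnorm x * rnorm y.
Proof.
have [->|y0] := eqVneq y 0.
  by rewrite inner0r rnorm0 mulr0 /cabs normr0.
pose u (i : nat) := ((rnorm y)^-1%:C)%C *: y.
have ou : orthonormal 1 u.
  move=> [|i] [|j] // _ _; rewrite /u inner_rnorm normalized //.
  by rewrite expr1n.
have := bessel x ou; rewrite big_ord_recl big_ord0 addr0.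
rewrite ler_sqr ?nnegrE ?cabs_ge0 ?rnorm_ge0 // innerZr cabsM.
have yp : 0 < rnorm y.
  by rewrite lt_def rnorm_ge0 andbT; apply: contra_neq y0; apply: rnorm0_eq0.
rewrite conjC_real cabs_real ger0_norm ?invr_ge0 ?rnorm_ge0 //.
by rewrite ler_pdivrMl // mulrC.
Qed.

(** Gram-Schmidt: the component of f m orthogonal to the span of the previous
vectors is normalized and adjoined to them, unless it vanishes. *)
Lemma orthonormal_span m (f : nat -> H) : exists r u, orthonormal r u /\
  forall k, (k < m)%N -> f k = oproj r u (f k).
Proof.
elim: m => [|m [r [u [ou fu]]]]; first by exists 0%N, f; split.
pose d := f m - oproj r u (f m).
have [d0|dn0] := eqVneq d 0.
  exists r, u; split=> // k; rewrite ltnS leq_eqVlt => /orP[/eqP->|/fu//].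
  by apply/eqP; rewrite -subr_eq0 -/d d0.
pose v := ((rnorm d)^-1%:C)%C *: d.
pose u' i := if i == r then v else u i.
have u'E i : (i < r)%N -> u' i = u i by move=> ir; rewrite /u' ltn_eqF.
have uv i : (i < r)%N -> inner v (u i) = 0.
  by move=> ir; rewrite /v innerZ oproj_orth // mulr0.
have vv : inner v v = 1 by rewrite inner_rnorm normalized // expr1n.
have ou' : orthonormal r.+1 u'.
  move=> i j; rewrite ltnS leq_eqVlt => /orP[/eqP->|ir];
    rewrite ltnS leq_eqVlt => /orP[/eqP->|jr].
  - by rewrite /u' eqxx vv.
  - by rewrite (u'E j) // /u' eqxx uv // gtn_eqF.
  - by rewrite (u'E i) // /u' eqxx innerC uv // conjC0 ltn_eqF.
  - by rewrite !u'E // ou.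
have recr w : oproj r.+1 u' w = oproj r u w + inner w v *: v.
  have u'r : u' r = v by rewrite /u' eqxx.
  rewrite /oproj big_ord_recr /= u'r; congr (_ + _).
  by apply: eq_bigr => i _; rewrite u'E ?ltn_ord.
exists r.+1, u'; split=> // k; rewrite ltnS leq_eqVlt recr => /orP[/eqP->|km].
  have dv : d = (rnorm d)%:C%C *: v.
    rewrite /v scalerA -rmorphM /= mulfV ?scale1r //.
    by apply: contra_neq dn0; apply: rnorm0_eq0.
  have -> : inner (f m) v = (rnorm d)%:C%C.
    rewrite -[f m](subrK (oproj r u (f m))) innerD -/d {1}dv innerZ vv mulr1.
    rewrite /oproj (inner_suml _ (fun i => inner (f m) (u i) *: u i)) big1 ?addr0 //.
    by move=> i _; rewrite innerZ [inner (u _) v]innerC uv // conjC0 mulr0.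
  by rewrite -dv addrC subrK.
suff -> : inner (f k) v = 0 by rewrite scale0r addr0; exact: fu.
rewrite fu // /oproj (inner_suml _ (fun i => inner (f k) (u i) *: u i)).
by rewrite big1 // => i _; rewrite innerZ [inner (u _) v]innerC uv // conjC0 mulr0.
Qed.

Section Basis.
Variables (e : nat -> H) (he : orthonormal_basis e).

Lemma basis_orthonormal n : orthonormal n e.
Proof. by move=> i j _ _; case: he. Qed.

Lemma basis_eq0 (d : H -> H) (M : R) : linear d ->
  (forall x, rnorm (d x) <= M * rnorm x) -> (forall k, d (e k) = 0) ->
  forall x, d x = 0.
Proof.
move=> dl dM de x; apply: rnorm_small => eps e0.
have d0 : d 0 = 0 by have := dl (-1) 0 0; rewrite addr0 scaler0 scaleN1r addNr.
have dD u v : d (u + v) = d u + d v by have := dl 1 u v; rewrite !scale1r.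
have dZ c v : d (c *: v) = c *: d v by have := dl c v 0; rewrite !addr0 d0 addr0.
have cl : closure [set x | exists (n : nat) (c : nat -> C), x = \sum_(k < n) c k *: e k] x.
  by case: he => _ ->.
have M1 : 0 < 1 + `|M| by rewrite ltr_pwDl.
have /closure_rnormP/(_ _ (divr_gt0 e0 M1)) [y [n [c yE]] xy] := cl.
have dy : d y = 0.
  rewrite yE; elim: n {yE} => [|n IH]; first by rewrite big_ord0 d0.
  by rewrite big_ord_recr /= dD IH dZ de scaler0 addr0.
rewrite -[x](subrK y) dD dy addr0 (le_trans (dM _)) //.
rewrite ltr_pdivlMr // in xy; apply: le_trans (ltW xy).
rewrite mulrC ler_wpM2l ?rnorm_ge0 //.
by rewrite (le_trans (ler_norm M)) // lerDr.
Qed.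

Lemma basis_inner_eq0 y : (forall k, inner y (e k) = 0) -> y = 0.
Proof.
move=> ye.
(* The bounded map x |-> <x, y> y vanishes on the basis, hence at y. *)
suff h x : inner x y *: y = 0.
  have := h y; rewrite inner_rnorm => /eqP; rewrite scaler_eq0 => /orP[|/eqP//].
  by rewrite -[X in _ == X]/((0 : R)%:C)%C (inj_eq (@complexI _)) sqrf_eq0 => /eqP/rnorm0_eq0.
apply: (@basis_eq0 (fun x => inner x y *: y) (rnorm y ^+ 2)) => [c u v|v|k] /=.
- by rewrite innerD innerZ scalerDl scalerA.
- rewrite rnormZ (le_trans (ler_wpM2r (rnorm_ge0 _) (cauchy_schwarz _ _))) //.
  by rewrite expr2 mulrC mulrCA mulrC mulrAC.
- by rewrite innerC ye conjC0 scale0r.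
Qed.
End Basis.
End Hilbert.

Section Representations.
Variables (R : realType).
Local Notation C := (Cfield R).
Variable H : hilbertType C.

Section StarAlg.
Variables (A : starAlgType C) (pi : A -> H -> H) (hpi : is_star_rep pi).

Lemma rep_x0 a : pi a 0 = 0.
Proof. by have := rep_linear hpi a (-1) 0 0; rewrite addr0 scaler0 scaleN1r addNr. Qed.

Lemma rep_xD a x y : pi a (x + y) = pi a x + pi a y.
Proof. by have := rep_linear hpi a 1 x y; rewrite !scale1r. Qed.

Lemma rep_xZ a c x : pi a (c *: x) = c *: pi a x.
Proof. by have := rep_linear hpi a c x 0; rewrite !addr0 rep_x0 addr0. Qed.

Lemma rep_xB a x y : pi a (x - y) = pi a x - pi a y.
Proof. by rewrite -scaleN1r rep_xD rep_xZ scaleN1r. Qed.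

Lemma rep_xsum a n (f : nat -> H) : pi a (\sum_(k < n) f k) = \sum_(k < n) pi a (f k).
Proof.
elim: n => [|n IH]; first by rewrite !big_ord0 rep_x0.
by rewrite !big_ord_recr /= rep_xD IH.
Qed.

Lemma repB a b x : pi (a - b) x = pi a x - pi b x.
Proof. by rewrite -scaleN1r (repD hpi) (repZ hpi) scaleN1r. Qed.

Lemma rep0 x : pi 0 x = 0.
Proof. by rewrite -(subrr 0) repB subrr. Qed.

Lemma rep_starl a x y : inner (pi (star a) x) y = inner x (pi a y).
Proof. by rewrite (rep_star hpi) starK. Qed.

Lemma rep_rbound a : exists2 M : R, 0 <= M & forall x, rnorm (pi a x) <= M * rnorm x.
Proof.
have [M hM] := rep_bounded hpi a; exists `|complex.Re M| => // x.
have := hM x; rewrite !rnormE lecE /= => /andP[_].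
have -> : complex.Re (M * (rnorm x)%:C%C) = complex.Re M * rnorm x.
  by case: (M) => m m'; rewrite /= mulr0 subr0.
move=> h; apply: (le_trans h).
by rewrite ler_wpM2r ?rnorm_ge0 // ler_norm.
Qed.

Lemma rnorm_rep_star_mul a x : (((rnorm (pi a x)) ^+ 2)%:C)%C = inner (pi (star a ** a) x) x :> C.
Proof. by rewrite (repM hpi) rep_starl inner_rnorm. Qed.
End StarAlg.

(** A representation of a C*-algebra is contractive: if |a| < 1 then
1 - a^* a = h h for some self-adjoint h. *)
Lemma rep_contractive (A : cstarAlgType C) (pi : A -> H -> H) :
  is_star_rep pi -> forall a x, rnorm (pi a x) <= rnorm a * rnorm x.
Proof.
move=> hpi.
have unit_ball a x : rnorm a < 1 -> rnorm (pi a x) <= rnorm x.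
  move=> a1; have a0 := rnorm_ge0 a.
  have [|||Y [_ sY YE]] := @cstar_sqrt _ _ (star a ** a) (rnorm a ^+ 2).
  - by rewrite sqr_ge0 expr_lt1.
  - by rewrite rnorm_cstar.
  - by rewrite starM starK.
  have hh : star (sone - Y) ** (sone - Y) = sone - star a ** a.
    have -> : star a ** a = Y + Y - Y ** Y by rewrite YE addrK.
    by rewrite starB star1 sY smulBl smul1 smulBr smulr1 !opprD !opprK !addrA.
  have := rnorm_rep_star_mul hpi (sone - Y) x.
  rewrite hh (repB hpi sone (star a ** a)) (rep1 hpi) innerBl -(rnorm_rep_star_mul hpi) inner_rnorm.
  rewrite -rmorphB /= => /complexI h.
  rewrite -(@ler_sqr _ (rnorm (pi a x))) ?nnegrE ?rnorm_ge0 // -subr_ge0 -h.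
  exact: sqr_ge0.
move=> a x; apply/ler_addgt0Pr => eps e0.
pose t := rnorm a + eps / (1 + rnorm x).
have x1 : 0 < 1 + rnorm x by rewrite ltr_pwDl // rnorm_ge0.
have at_ : rnorm a < t by rewrite ltrDl divr_gt0.
have t0 : 0 < t by apply: le_lt_trans at_; apply: rnorm_ge0.
have := unit_ball ((t^-1%:C)%C *: a) x.
have ti : 0 <= t^-1 by rewrite invr_ge0 ltW.
rewrite (repZ hpi) !rnormZr ger0_norm //.
rewrite ltr_pdivrMl // mulr1 ler_pdivrMl // => /(_ at_) h.
rewrite (le_trans h) // /t mulrDl lerD2l mulrAC ler_pdivrMr //.
by rewrite ler_wpM2l ?lerDr // ltW.
Qed.
End Representations.

Section Closure.
Variables (R : realType).
Local Notation C := (Cfield R).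
Variables (A : starAlgType C) (B : cstarAlgType C) (i : A -> B).
Hypothesis hi : is_cstar_closure i.

Lemma closure_rep_le (H : hilbertType C) (pi : A -> H -> H) a x :
  is_star_rep pi -> rnorm (pi a x) <= rnorm (i a) * rnorm x.
Proof.
move=> hpi; have [->|x0] := eqVneq x 0; first by rewrite (rep_x0 hpi) !rnorm0 mulr0.
have [ub _] := closure_norm hi a.
have xp : 0 < rnorm x.
  by rewrite lt_def rnorm_ge0 andbT; apply: contra_neq x0; apply: rnorm0_eq0.
suff : rnorm (pi a (((rnorm x)^-1%:C)%C *: x)) <= rnorm (i a).
  rewrite (rep_xZ hpi) rnormZr ger0_norm ?invr_ge0 ?rnorm_ge0 //.
  by rewrite ler_pdivrMl // mulrC.
rewrite -lecR -!rnormE; apply: ub; exists H, pi, (((rnorm x)^-1%:C)%C *: x).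
by split=> //; rewrite rnormE normalized.
Qed.

Lemma closure_norm_le a (M : R) :
  (forall (H : hilbertType C) (pi : A -> H -> H) x, is_star_rep pi ->
    rnorm x <= 1 -> rnorm (pi a x) <= M) -> rnorm (i a) <= M.
Proof.
move=> h; have [_ lub] := closure_norm hi a.
rewrite -lecR -rnormE; apply: lub => _ [H [pi [x [hpi x1 ->]]]].
by rewrite rnorm_le h // -lecR -rnormE.
Qed.

Lemma closure_approx b (eps : R) : 0 < eps -> exists a, rnorm (b - i a) < eps.
Proof.
move=> e0; have : closure (range i) b by rewrite (closure_dense hi).
by move=> /closure_rnormP /(_ _ e0) [_ [a _ <-] h]; exists a.
Qed.

End Closure.

(** A representation of A' composed with f is a representation of A. *)
Lemma closure_hom_contractive (R : realType) (A A' : starAlgType (Cfield R))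
    (B B' : cstarAlgType (Cfield R)) (i : A -> B) (i' : A' -> B') (f : A -> A') :
  is_cstar_closure i -> is_cstar_closure i' -> is_star_hom f ->
  forall a, rnorm (i' (f a)) <= rnorm (i a).
Proof.
move=> hi hi' hf a; apply: (closure_norm_le hi') => H pi x hpi x1.
apply: le_trans (closure_rep_le hi _ _ (star_rep_comp hf hpi)) _.
by rewrite ler_piMr ?rnorm_ge0.
Qed.

(** * Extension to C*-closures *)

Section Extensions.
Variables (R : realType).
Local Notation C := (Cfield R).

Section Dense.
Variables (A : starAlgType C) (B : cstarAlgType C) (i : A -> B).
Hypothesis hi : is_cstar_closure i.
Local Notation i_hom := (closure_hom hi).

Lemma dense_eq0 (Z : normedModType C) (d : B -> Z) (M : R) :
  (forall x y, d (x + y) = d x + d y) -> (forall b, rnorm (d b) <= M * rnorm b) ->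
  (forall a, d (i a) = 0) -> forall b, d b = 0.
Proof.
move=> dD dM di b; apply: rnorm_small => eps e0.
have M1 : 0 < 1 + `|M| by rewrite ltr_pwDl.
have [a ha] := closure_approx hi b (divr_gt0 e0 M1).
rewrite -[b](subrK (i a)) dD di addr0 (le_trans (dM _)) //.
rewrite ltr_pdivlMr // in ha; apply: le_trans (ltW ha).
by rewrite mulrC ler_wpM2l ?rnorm_ge0 // (le_trans (ler_norm M)) // lerDr.
Qed.

Lemma closure_extend (Z : completeNormedModType C) (g : A -> Z) (M : R) : 0 <= M ->
  (forall a b, g (a + b) = g a + g b) -> (forall (c : C) a, g (c *: a) = c *: g a) ->
  (forall a, rnorm (g a) <= M * rnorm (i a)) ->
  exists G : B -> Z, [/\ forall x y, G (x + y) = G x + G y,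
    forall (c : C) x, G (c *: x) = c *: G x,
    forall a, G (i a) = g a & forall b, rnorm (G b) <= M * rnorm b].
Proof.
move=> M0 gD gZ gM.
have [G hG] := bounded_extension M0 (star_homD i_hom) (star_homZ i_hom) gD gZ
  (closure_dense hi) gM.
have small (x : Z) D : 0 <= D -> (forall eps, 0 < eps -> rnorm x <= D * eps) -> x = 0.
  move=> D0 h; apply: rnorm_small => eps e0.
  have D1 : 0 < 1 + D by rewrite ltr_pwDl.
  apply: le_trans (h _ (divr_gt0 e0 D1)) _.
  by rewrite mulrA ler_pdivrMr // mulrC ler_wpM2l ?lerDr // ltW.
have g0 : g 0 = 0 by apply: (addrI (g 0)); rewrite -gD !addr0.
have Gi a : G (i a) = g a.
  apply/eqP; rewrite -subr_eq0; apply/eqP/rnorm_small => eps e0.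
  by have := hG (i a) a; rewrite subrr rnorm0 mulr0 => h; apply: (le_trans h); apply: ltW.
exists G; split=> //.
- move=> x y; apply/eqP; rewrite -subr_eq0; apply/eqP.
  apply: (@small _ (M * 4)); first by rewrite mulr_ge0.
  move=> eps e0; have [a ha] := closure_approx hi x e0.
  have [b hb] := closure_approx hi y e0.
  have -> : G (x + y) - (G x + G y) =
      (G (x + y) - g (a + b)) - ((G x - g a) + (G y - g b)).
    by rewrite gD [(G x - _) + _]addrACA -opprD opprB addrA subrK.
  apply: le_trans (rnormB _ _) _.
  have h1 := hG (x + y) (a + b); have h2 := rnormD (G x - g a) (G y - g b).
  have h3 := hG x a; have h4 := hG y b.
  rewrite (star_homD i_hom) opprD addrACA in h1.
  have h5 := ler_wpM2l M0 (rnormD (x - i a) (y - i b)).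
  have h6 := ler_wpM2l M0 (ltW ha); have h7 := ler_wpM2l M0 (ltW hb).
  rewrite mulrDr in h5; rewrite mulrAC; lra.
- move=> c x; apply/eqP; rewrite -subr_eq0; apply/eqP.
  apply: (@small _ (2 * cabs c * M)); first by rewrite !mulr_ge0 ?cabs_ge0.
  move=> eps e0; have [a ha] := closure_approx hi x e0.
  have -> : G (c *: x) - c *: G x = (G (c *: x) - g (c *: a)) - c *: (G x - g a).
    by rewrite gZ scalerBr opprB addrA subrK.
  apply: le_trans (rnormB _ _) _; rewrite rnormZ.
  have h1 := hG (c *: x) (c *: a).
  rewrite (star_homZ i_hom) -scalerBr rnormZ mulrCA in h1.
  have c0 := cabs_ge0 c.
  have h2 := ler_wpM2l c0 (hG x a).
  have h3 := ler_wpM2l c0 (ler_wpM2l M0 (ltW ha)).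
  rewrite -!mulrA; lra.
- move=> b; have := hG b 0; rewrite g0 subr0 (star_hom0 i_hom) subr0; exact.
Qed.

(** Each map a |-> pi a v is bounded by |v| for the norm of B, hence extends; the
identities defining a representation pass to the limit in one variable at a
time. *)
Lemma closure_rep (K : hilbertType C) (pi : A -> K -> K) : is_star_rep pi ->
  exists E : B -> K -> K, is_star_rep E /\ forall a v, E (i a) v = pi a v.
Proof.
move=> hpi.
have /choice[G hG] (v : K) : exists G : B -> K, [/\ forall x y, G (x + y) = G x + G y,
    forall (c : C) x, G (c *: x) = c *: G x,
    forall a, G (i a) = pi a v & forall b, rnorm (G b) <= rnorm v * rnorm b].
  apply: closure_extend => [|a b|c a|a]; first exact: rnorm_ge0.
  - exact: repD hpi _ _ _.
  - exact: repZ hpi _ _ _.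
  - by rewrite mulrC; apply: closure_rep_le.
pose E b v := G v b.
have ED v x y : E (x + y) v = E x v + E y v by case: (hG v) => h *; apply: h.
have EZ v c x : E (c *: x) v = c *: E x v by case: (hG v) => _ h *; apply: h.
have Ei a v : E (i a) v = pi a v by case: (hG v) => _ _ h *; apply: h.
have EM b v : rnorm (E b v) <= rnorm b * rnorm v.
  by rewrite mulrC; case: (hG v) => _ _ _ h *; apply: h.
have Elin b : linear (E b).
  move=> c v w; apply/eqP; rewrite -subr_eq0; apply/eqP; move: b.
  apply: (@dense_eq0 _ _ (rnorm (c *: v + w) + (cabs c * rnorm v + rnorm w))).
  - by move=> x y; rewrite !ED scalerDr (addrACA (c *: _)) opprD addrACA.
  - move=> b; apply: le_trans (rnormB _ _) _; rewrite mulrDl.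
    apply: lerD; first by rewrite mulrC.
    apply: le_trans (rnormD _ _) _; rewrite mulrDl.
    apply: lerD; last by rewrite mulrC.
    by rewrite rnormZ -mulrA ler_wpM2l ?cabs_ge0 // mulrC.
  - by move=> a; rewrite !Ei (rep_xD hpi) (rep_xZ hpi) subrr.
have ExD b v w : E b (v + w) = E b v + E b w by have := Elin b 1 v w; rewrite !scale1r.
have EMl a b v : E (i a ** b) v = E (i a) (E b v).
  apply/eqP; rewrite -subr_eq0; apply/eqP; move: b.
  apply: (@dense_eq0 _ _ (rnorm (i a) * rnorm v + rnorm (i a) * rnorm v)).
  - by move=> x y; rewrite smulDr !ED ExD opprD addrACA.
  - move=> b; apply: le_trans (rnormB _ _) _; rewrite mulrDl; apply: lerD.
      apply: le_trans (EM _ _) _; rewrite mulrAC ler_wpM2r ?rnorm_ge0 //.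
      exact: rnormM.
    apply: le_trans (EM _ _) _; rewrite -mulrA ler_wpM2l ?rnorm_ge0 // mulrC.
    exact: EM.
  - by move=> a'; rewrite -(star_homM i_hom) !Ei (repM hpi) subrr.
have EMr a b v : E (a ** b) v = E a (E b v).
  apply/eqP; rewrite -subr_eq0; apply/eqP; move: a.
  apply: (@dense_eq0 _ _ (rnorm b * rnorm v + rnorm b * rnorm v)).
  - by move=> x y; rewrite smulDl !ED opprD addrACA.
  - move=> a; apply: le_trans (rnormB _ _) _; rewrite mulrDl; apply: lerD.
      apply: le_trans (EM _ _) _; rewrite mulrAC ler_wpM2r ?rnorm_ge0 // mulrC.
      exact: rnormM.
    apply: le_trans (EM _ _) _; rewrite mulrC ler_wpM2r ?rnorm_ge0 //.
  - by move=> a; rewrite EMl subrr.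
exists E; split=> //; split=> //.
- move=> b; exists ((rnorm b)%:C)%C => v.
  by rewrite !rnormE -rmorphM lecR.
- by move=> v; rewrite -(star_hom1 i_hom) Ei (rep1 hpi).
- move=> a v w; have [->|w0] := eqVneq w 0.
    have E0 b : E b 0 = 0 by apply: (addrI (E b 0)); rewrite -ExD !addr0.
    by rewrite E0 !inner0r.
  (* The scalar multiplies w because the density argument is about vectors. *)
  suff : forall a, (inner (E a v) w - inner v (E (star a) w)) *: w = 0.
    move=> /(_ a)/eqP; rewrite scaler_eq0 (negPf w0) orbF subr_eq0 => /eqP; exact.
  apply: (@dense_eq0 _ _ (2 * rnorm v * rnorm w * rnorm w)).
  - move=> x y; rewrite starD !ED innerD innerDr opprD addrACA scalerDl //.
  - move=> b; rewrite rnormZ [X in _ <= X]mulrAC ler_wpM2r ?rnorm_ge0 //.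
    have cabsB (x y : C) : cabs (x - y) <= cabs x + cabs y.
      by rewrite -lecR rmorphD /= -!cabsE ler_normB.
    apply: le_trans (cabsB _ _) _.
    have h1 := cauchy_schwarz (E b v) w; have h2 := cauchy_schwarz v (E (star b) w).
    have h3 := ler_wpM2r (rnorm_ge0 w) (EM b v).
    have h4 := ler_wpM2l (rnorm_ge0 v) (EM (star b) w); rewrite rnorm_star in h4.
    have -> : 2 * rnorm v * rnorm w * rnorm b =
      rnorm b * rnorm v * rnorm w + rnorm v * (rnorm b * rnorm w) by ring.
    by apply: lerD; [apply: le_trans h1 h3|apply: le_trans h2 h4].
  - by move=> a'; rewrite -(star_hom_star i_hom) !Ei (rep_star hpi) subrr scale0r.
Qed.
End Dense.

(** The norm of a C*-closure is a supremum over representations, so f is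
contractive; it extends by continuity, as do the algebraic identities. *)
Lemma closure_extend_hom (A A' : starAlgType C) (B B' : cstarAlgType C)
    (i : A -> B) (i' : A' -> B') (f : A -> A') :
  is_cstar_closure i -> is_cstar_closure i' -> is_star_hom f ->
  exists F : B -> B', [/\ is_star_hom F, forall a, F (i a) = i' (f a) &
    forall b, rnorm (F b) <= rnorm b].
Proof.
move=> hi hi' hf; have hg := star_hom_comp hf (closure_hom hi').
have i_hom := closure_hom hi.
have [|F [FD FZ Fi F1]] := @closure_extend _ _ _ hi B' (i' \o f) 1 ler01
    (star_homD hg) (star_homZ hg).
  by move=> a; rewrite mul1r; exact: (closure_hom_contractive hi hi' hf).
have FC b : rnorm (F b) <= rnorm b by rewrite (le_trans (F1 b)) // mul1r.
have FMl a b : F (i a ** b) = F (i a) ** F b.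
  apply/eqP; rewrite -subr_eq0; apply/eqP; move: b.
  apply: (dense_eq0 hi (M := rnorm (i a) + rnorm (i a))).
  - move=> x y; rewrite smulDr !FD smulDr opprD. by rewrite addrACA.
  - move=> b; apply: le_trans (rnormB _ _) _; rewrite mulrDl; apply: lerD.
      exact: le_trans (FC _) (rnormM _ _).
    by apply: le_trans (rnormM _ _) _; apply: ler_pM; rewrite ?rnorm_ge0.
  - by move=> a'; rewrite -(star_homM i_hom) !Fi (star_homM hg) subrr.
have FM a b : F (a ** b) = F a ** F b.
  apply/eqP; rewrite -subr_eq0; apply/eqP; move: a.
  apply: (dense_eq0 hi (M := rnorm b + rnorm b)).
  - by move=> x y; rewrite smulDl !FD smulDl opprD addrACA.
  - move=> a; apply: le_trans (rnormB _ _) _; rewrite mulrDl mulrC; apply: lerD.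
      exact: le_trans (FC _) (rnormM _ _).
    by apply: le_trans (rnormM _ _) _; apply: ler_pM; rewrite ?rnorm_ge0.
  - by move=> a; rewrite FMl subrr.
exists F; split=> //; split=> //.
- by rewrite -(star_hom1 i_hom) Fi (star_hom1 hg).
- move=> a; apply/eqP; rewrite -subr_eq0; apply/eqP; move: a.
  apply: (dense_eq0 hi (M := 2)).
  - by move=> x y; rewrite starD !FD starD opprD addrACA.
  - move=> a; apply: le_trans (rnormB _ _) _; rewrite rnorm_star mulr_natl mulr2n.
    by apply: lerD => //; rewrite -[X in _ <= X]rnorm_star.
  - by move=> a; rewrite -(star_hom_star i_hom) !Fi (star_hom_star hg) subrr.
Qed.
End Extensions.

(** * Free *-algebras, generators and relations *)

Section FreeStarAlgebraUniversal.
Variables (C : numClosedFieldType) (n : nat).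
Local Notation word := (fmonom ('I_n * bool)%type).
Local Notation F := (malg word C).

Lemma malg_sum_msupp (B : lmodType C) (h : word -> B) (g : F) (d : {fset word}) :
  (fsubset (msupp g) d) ->
  \sum_(w <- msupp g) mcoeff w g *: h w = \sum_(w <- d) mcoeff w g *: h w.
Proof.
by move=> gd; apply: big_fset_incl => // w _ /mcoeff_outdom ->; rewrite scale0r.
Qed.

Lemma fmonom_mulE (s t : seq ('I_n * bool)) :
  monalg.mul (FMonom s) (FMonom t) = FMonom (s ++ t) :> word.
Proof. by apply/eqP; rewrite -val_eqE; apply/eqP; exact: fmM. Qed.

Section Lift.
Variables (B : starAlgType C) (b : 'I_n -> B).

Definition letter_eval (l : 'I_n * bool) : B := if l.2 then star (b l.1) else b l.1.

Definition word_eval (w : word) : B :=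
  foldr (fun l x => letter_eval l ** x) sone (fmonom_val w).

Lemma word_evalM v w : word_eval (monalg.mul v w) = word_eval v ** word_eval w.
Proof.
case: v w => [s] [t]; rewrite fmonom_mulE /word_eval /=.
by elim: s => [|l s IH] /=; rewrite ?smul1 // IH smulA.
Qed.

Lemma word_eval_star w : word_eval (word_star w) = star (word_eval w).
Proof.
case: w => s; rewrite /word_eval /word_star /=.
elim: s => [|l s IH] /=; first by rewrite star1.
rewrite rev_cons -cats1 starM -IH foldr_cat /= smulr1.
have -> : letter_eval (l.1, ~~ l.2) = star (letter_eval l).
  by rewrite /letter_eval; case: l => i [] /=; rewrite ?starK.
by elim: (rev _) => [|m u IHu] /=; rewrite ?smul1 // IHu smulA.
Qed.

Definition malg_eval (g : F) : B := \sum_(w <- msupp g) mcoeff w g *: word_eval w.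

Lemma malg_evalD g h : malg_eval (g + h) = malg_eval g + malg_eval h.
Proof.
rewrite /malg_eval (malg_sum_msupp _ (msuppD_le g h)).
rewrite (malg_sum_msupp _ (fsubsetUl (msupp g) (msupp h))).
rewrite (malg_sum_msupp _ (fsubsetUr (msupp g) (msupp h))) -big_split /=.
by apply: eq_bigr => w _; rewrite mcoeffD scalerDl.
Qed.

Lemma malg_evalZ (c : C) g : malg_eval (c *: g) = c *: malg_eval g.
Proof.
rewrite /malg_eval (malg_sum_msupp _ (msuppZ_le c g)) scaler_sumr.
by apply: eq_bigr => w _; rewrite mcoeffZ scalerA.
Qed.

Lemma malg_evalU w (c : C) : malg_eval (mkmalgU w c) = c *: word_eval w.
Proof.
by rewrite /malg_eval (malg_sum_msupp _ msuppU_le) big_seq_fset1 mcoeffUU.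
Qed.

Lemma malg_eval0 : malg_eval 0 = 0.
Proof. by rewrite -(scale0r (0 : F)) malg_evalZ scale0r. Qed.

Lemma malg_eval_sum (I : Type) (r : seq I) (G : I -> F) :
  malg_eval (\sum_(i <- r) G i) = \sum_(i <- r) malg_eval (G i).
Proof. exact: (big_morph _ malg_evalD malg_eval0). Qed.

Lemma smul_suml (I : Type) (r : seq I) (G : I -> B) x :
  (\sum_(i <- r) G i) ** x = \sum_(i <- r) G i ** x.
Proof. exact: (big_morph _ (fun u v => smulDl u v x) (smul0l x)). Qed.

Lemma smul_sumr (I : Type) (r : seq I) (G : I -> B) x :
  x ** (\sum_(i <- r) G i) = \sum_(i <- r) x ** G i.
Proof. exact: (big_morph _ (smulDr x) (smul0r x)). Qed.

Lemma star_sum (I : Type) (r : seq I) (G : I -> B) :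
  star (\sum_(i <- r) G i) = \sum_(i <- r) star (G i).
Proof. exact: (big_morph _ (@starD _ B) (star0 B)). Qed.

Lemma malg_evalM g h : malg_eval (g * h) = malg_eval g ** malg_eval h.
Proof.
rewrite malgME malg_eval_sum [malg_eval g]/malg_eval smul_suml.
apply: eq_bigr => v _; rewrite malg_eval_sum [malg_eval h]/malg_eval smul_sumr.
apply: eq_bigr => w _.
by rewrite malg_evalU word_evalM smulZl smulZr scalerA.
Qed.

Lemma malg_eval_star g : malg_eval (malg_star (@word_star n) g) = star (malg_eval g).
Proof.
rewrite /malg_star malg_eval_sum [malg_eval g]/malg_eval star_sum.
by apply: eq_bigr => w _; rewrite malg_evalU word_eval_star starZ.
Qed.

Lemma free_star_alg_lift : exists f : free_star_alg C n -> B,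
  is_star_hom f /\ forall i, f (free_gen C i) = b i.
Proof.
exists (malg_eval : free_star_alg C n -> B); split; last first.
  move=> i; rewrite free_gen.unlock malg_evalU scale1r /word_eval /=.
  by rewrite smulr1.
split=> [g h|c g|g h||g].
- exact: malg_evalD.
- exact: malg_evalZ.
- have -> : g ** h = free_mul g h by [].
  by rewrite free_mul.unlock; exact: malg_evalM.
- have -> : sone = free_one C n by [].
  rewrite free_one.unlock.
  have -> : (1 : F) = mkmalgU (FMonom [::]) 1 by rewrite -fmoneE.
  by rewrite malg_evalU scale1r.
- have -> : star g = free_star g by [].
  by rewrite free_star.unlock; exact: malg_eval_star.
Qed.
End Lift.

Lemma free_star_alg_ind (P : free_star_alg C n -> Prop) :
  P sone -> (forall (c : C) a, P a -> P (c *: a)) ->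
  (forall a b, P a -> P b -> P (a + b)) -> (forall a b, P a -> P b -> P (a ** b)) ->
  (forall i, P (free_gen C i)) -> (forall i, P (star (free_gen C i))) ->
  forall a, P a.
Proof.
move=> P1 PZ PD PM Pg Ps a.
have oneE : (sone : free_star_alg C n) = (mkmalgU (FMonom [::]) 1 : F).
  have -> : (sone : free_star_alg C n) = free_one C n by [].
  by rewrite free_one.unlock -fmoneE.
have Pl l : P (mkmalgU (FMonom [:: l]) 1 : F).
  case: l => i []; last by have := Pg i; rewrite free_gen.unlock.
  have := Ps i; have -> : star (free_gen C i) = free_star (free_gen C i) by [].
  rewrite free_star.unlock free_gen.unlock (malg_starU (@word_starK n)).
  by rewrite conjC1.
have Pw s : P (mkmalgU (FMonom s) 1 : F).
  elim: s => [|l s IH]; first by rewrite -oneE.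
  have := PM _ _ (Pl l) IH.
  set g := (X in P X -> _); suff -> : g = mkmalgU (FMonom (l :: s)) 1 by [].
  rewrite /g; have -> : forall u v : free_star_alg C n, u ** v = free_mul u v by [].
  rewrite free_mul.unlock.
  have := fgmulUU (1 : C) 1 (FMonom [:: l]) (FMonom s).
  by rewrite fmonom_mulE mulr1.
rewrite -[a]/(a : F) [a : F]monalgE.
elim: (enum_fset (msupp _)) => [|w r IH].
  rewrite big_nil; have := PZ 0 _ P1.
  by rewrite scale0r.
rewrite big_cons; apply: PD => //.
have -> : mkmalgU w (mcoeff w a) = mcoeff w a *: mkmalgU w 1 :> F.
  by apply/malgP => v; rewrite mcoeffZ !mcoeffU mulr_natr.
by apply: PZ; case: w.
Qed.
End FreeStarAlgebraUniversal.

Section Presented.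
Variables (C : numClosedFieldType) (n : nat) (S : set (free_star_alg C n)).
Local Notation gen i := (star_proj S (free_gen C i)).

Lemma star_quot_lift (B : starAlgType C) (f : free_star_alg C n -> B) :
  is_star_hom f -> (forall a, S a -> f a = 0) ->
  exists2 g : star_quot S -> B, is_star_hom g & forall a, g (star_proj S a) = f a.
Proof.
move=> hf fS.
have fI a : star_ideal S a -> f a = 0.
  elim=> {a} [a /fS //||a b _ fa _ fb|a b _ fb|a b _ fa|a _ fa].
  - exact: star_hom0.
  - by rewrite (star_homD hf) fa fb addr0.
  - by rewrite (star_homM hf) fb smul0r.
  - by rewrite (star_homM hf) fa smul0l.
  - by rewrite (star_hom_star hf) fa star0.
pose g (x : star_quot S) := f (repr x).
have gE a : g (star_proj S a) = f a.
  apply/eqP; rewrite -subr_eq0 -(star_homB _ _ hf); apply/eqP/fI/star_projP.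
  by rewrite star_projK.
have hp := @star_proj_is_star_hom _ _ S.
exists g => //; split.
- by elim/star_ind=> a; elim/star_ind=> b; rewrite -(star_homD hp) !gE (star_homD hf).
- by move=> c; elim/star_ind=> a; rewrite -(star_homZ hp) !gE (star_homZ hf).
- by elim/star_ind=> a; elim/star_ind=> b; rewrite -(star_homM hp) !gE (star_homM hf).
- by rewrite -(star_hom1 hp) gE (star_hom1 hf).
- by elim/star_ind=> a; rewrite -(star_hom_star hp) !gE (star_hom_star hf).
Qed.

Lemma star_quot_ind (P : star_quot S -> Prop) :
  P sone -> (forall (c : C) a, P a -> P (c *: a)) ->
  (forall a b, P a -> P b -> P (a + b)) -> (forall a b, P a -> P b -> P (a ** b)) ->
  (forall i, P (gen i)) -> (forall i, P (star (gen i))) ->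
  forall a, P a.
Proof.
have hp := @star_proj_is_star_hom _ _ S.
move=> P1 PZ PD PM Pg Ps; elim/star_ind; apply: free_star_alg_ind => //.
- by move=> c a Pa; rewrite (star_homZ hp); apply: PZ.
- by move=> a b Pa Pb; rewrite (star_homD hp); apply: PD.
- by move=> a b Pa Pb; rewrite (star_homM hp); apply: PM.
- by move=> i; rewrite (star_hom_star hp).
Qed.
End Presented.

Lemma star_hom_combination (C : numClosedFieldType) (A B : starAlgType C) (f : A -> B)
    (c d : C) x y z : is_star_hom f ->
  f (x - c *: y - d *: z) = f x - c *: f y - d *: f z.
Proof. by move=> hf; rewrite !(star_homB _ _ hf) !(star_homZ hf). Qed.

Section Relations.
Variable C : numClosedFieldType.

Section Sphere.
Variable q : C.
Local Notation A := (sphereA q).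
Local Notation B := (sphereB q).
Local Notation hp := (@star_proj_is_star_hom C (free_star_alg C 2) (sphere_rel q)).

Let relP (a : free_star_alg C 2) : sphere_rel q a -> star_proj (sphere_rel q) a = 0.
Proof.
by move=> ra; rewrite -(star_hom0 hp); apply/star_projP; rewrite subr0; apply: star_ideal_gen.
Qed.

Let homE := (fun a b => star_homB a b hp, star_homD hp, fun a => star_homN a hp, star_homZ hp,
  star_homM hp, star_hom1 hp, star_hom_star hp).

Lemma sphere_starA : star A = A.
Proof.
have /relP : sphere_rel q (star (free_gen C ord0) - free_gen C ord0) by left; left; left.
by rewrite !homE => /eqP; rewrite subr_eq0 => /eqP.
Qed.

Lemma sphere_BA : B ** A = q ^+ 2 *: (A ** B).
Proof.
have /relP : sphere_rel q (free_gen C ord_max ** free_gen C ord0 -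
  q ^+ 2 *: (free_gen C ord0 ** free_gen C ord_max)) by left; left; right.
by rewrite !homE => /eqP; rewrite subr_eq0 => /eqP.
Qed.

Lemma sphere_BsB : star B ** B = - (A ** A) + sone.
Proof.
have /relP : sphere_rel q (star (free_gen C ord_max) ** free_gen C ord_max -
  (- (free_gen C ord0 ** free_gen C ord0) + sone)) by left; right.
by rewrite !homE => /eqP; rewrite subr_eq0 => /eqP.
Qed.

Lemma sphere_BBs : B ** star B = - (q ^+ 4 *: (A ** A)) + sone.
Proof.
have /relP : sphere_rel q (free_gen C ord_max ** star (free_gen C ord_max) -
  (- (q ^+ 4 *: (free_gen C ord0 ** free_gen C ord0)) + sone)) by right.
by rewrite !homE => /eqP; rewrite subr_eq0 => /eqP.
Qed.

Lemma sphere_ind (P : PSphere q -> Prop) :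
  P sone -> (forall (c : C) a, P a -> P (c *: a)) ->
  (forall a b, P a -> P b -> P (a + b)) -> (forall a b, P a -> P b -> P (a ** b)) ->
  P A -> P B -> P (star A) -> P (star B) -> forall a, P a.
Proof.
have gen (Q : 'I_2 -> Prop) : Q ord0 -> Q ord_max -> forall j, Q j.
  move=> Q0 Q1 [[|[|//]] j2].
    by rewrite (_ : Ordinal j2 = ord0) //; apply: val_inj.
  by rewrite (_ : Ordinal j2 = ord_max) //; apply: val_inj.
by move=> P1 PZ PD PM PA PB PsA PsB; apply: star_quot_ind => //; apply: gen.
Qed.
End Sphere.

Section Disc.
Variable s : C.
Definition disc_x : PDisc s := star_proj (disc_rel s) (free_gen C ord0).
Local Notation x := disc_x.

Lemma disc_xP : star x ** x = s *: (x ** star x) + (1 - s) *: sone.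
Proof.
have hp := @star_proj_is_star_hom C (free_star_alg C 1) (disc_rel s).
have : star_proj (disc_rel s) (star (free_gen C ord0) ** free_gen C ord0 -
    s *: (free_gen C ord0 ** star (free_gen C ord0)) - (1 - s) *: sone) = 0.
  by rewrite -(star_hom0 hp); apply/star_projP; rewrite subr0; apply: star_ideal_gen.
rewrite (star_hom_combination _ _ _ _ _ hp) 2!(star_homM hp).
rewrite (star_hom_star hp) (star_hom1 hp).
by move=> /eqP; rewrite -addrA -opprD subr_eq0 => /eqP.
Qed.

Lemma disc_ind (P : PDisc s -> Prop) :
  P sone -> (forall (c : C) a, P a -> P (c *: a)) ->
  (forall a b, P a -> P b -> P (a + b)) -> (forall a b, P a -> P b -> P (a ** b)) ->
  P x -> P (star x) -> forall a, P a.
Proof.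
by move=> P1 PZ PD PM Px Psx; apply: star_quot_ind => // j; rewrite ord1.
Qed.

Lemma disc_lift (B : starAlgType C) (b : B) :
  star b ** b = s *: (b ** star b) + (1 - s) *: sone ->
  exists2 f : PDisc s -> B, is_star_hom f & f x = b.
Proof.
move=> hb; have [g [hg gb]] := free_star_alg_lift (fun _ : 'I_1 => b).
have [|f hf fg] := star_quot_lift hg (S := disc_rel s); last first.
  by exists f => //; rewrite /disc_x fg gb.
move=> _ ->; rewrite (star_hom_combination _ _ _ _ _ hg) 2!(star_homM hg).
rewrite (star_hom_star hg) (star_hom1 hg).
by rewrite gb hb -addrA -opprD subrr.
Qed.
End Disc.
End Relations.

(** * Polar decomposition of the disc generator *)

Section DiscPolar.
Variables (R : realType).
Local Notation C := (Cfield R).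
Variables (A : cstarAlgType C).

Definition spow (a : A) k := iter k (smul a) sone.

Lemma spow_comm a k : spow a k ** a = a ** spow a k.
Proof. by elim: k => [|k IH] /=; rewrite ?smul1 ?smulr1 // -smulA IH. Qed.

Lemma rnorm_coisometry (V : A) : V ** star V = sone -> rnorm V <= 1.
Proof.
move=> VV; have := rnorm_cstar (star V); rewrite starK VV rnorm_star => h.
have := rnorm1_le A; rewrite h => h1.
by rewrite -(@ler_sqr _ _ 1) ?nnegrE ?rnorm_ge0 // expr1n.
Qed.

Lemma rnorm_spow (V : A) k : rnorm V <= 1 -> rnorm (spow V k) <= 1.
Proof.
move=> V1; elim: k => [|k IH] /=; first exact: rnorm1_le.
by rewrite (le_trans (rnormM _ _)) // mulr_ile1 ?rnorm_ge0.
Qed.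

Variables (s : R) (T : A).
Hypothesis s01 : 0 < s < 1.
Hypothesis T_rel : star T ** T = (s%:C)%C *: (T ** star T) + ((1 - s)%:C)%C *: sone.
Local Notation D := (sone - T ** star T).
Hypothesis D1 : rnorm D <= 1.

(** As |s D| <= s < 1, the element T^* T = 1 - s D is invertible, and T has a polar
decomposition T = V^* h where h = 1 - Y is the square root of T^* T. The relation
T^* D = s D T^* passes to V, so that V^k D = s^k D V^k tends to 0, and with it
V^k (1 - h). On the other hand P = 1 - V^* V satisfies P D = P, so P V^k D is
s^k P V^k: on the right of P V^k, the element h h = 1 - s D acts as the scalar
1 - s^(k+1), and h as its square root. *)
Lemma disc_polar : exists V h : A, [/\ V ** star V = sone, T = star V ** h, star h = h,
  forall k, (sone - star V ** V) ** spow V k ** h =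
    ((Num.sqrt (1 - s ^+ k.+1))%:C)%C *: ((sone - star V ** V) ** spow V k) &
  forall k, rnorm (spow V k ** (sone - h)) <= s ^+ k.+1].
Proof.
have /andP[s0 s1] := s01; have s01' : 0 <= s < 1 by rewrite ltW.
have sD : star D = D by rewrite starB star1 starM starK.
have TT : star T ** T = sone - (s%:C)%C *: D.
  rewrite T_rel rmorphB /= scalerBl scale1r scalerBr opprB.
  by rewrite addrC -addrA; congr (_ + _); rewrite addrC.
have [|||Y [Ys sY YE]] := @cstar_sqrt _ A ((s%:C)%C *: D) s => //.
- rewrite rnormZr gtr0_norm //; apply: le_trans (ler_wpM2l (ltW s0) D1) _.
  by rewrite mulr1.
- by rewrite starZ conjC_real sD.
pose h : A := sone - Y.
have hh : h ** h = star T ** T.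
  have -> : star T ** T = sone - (Y + Y - Y ** Y) by rewrite TT YE addrK.
  by rewrite /h smulBl smul1 smulBr smulr1 !opprD !opprK !addrA.
have [Z [sZ hZ Zh]] := cstar_inv s01' Ys sY; rewrite -/h in hZ Zh.
pose V := Z ** star T.
have sV : star V = T ** Z by rewrite starM starK sZ.
have VV : V ** star V = sone.
  by rewrite sV /V !smulA -(smulA Z) -hh !smulA Zh smul1 hZ.
have hV : h ** V = star T by rewrite /V smulA hZ smul1.
have TV : T = star V ** h.
  by rewrite -[LHS]starK -hV starM /h starB star1 sY.
have TD : star T ** D = (s%:C)%C *: (D ** star T).
  rewrite smulBr smulr1 smulA -[X in X - _]smul1 -smulBl TT opprB.
  by rewrite addrC subrK smulZl.
have DY : D ** Y = Y ** D.
  have s0' : (s%:C)%C != 0 :> C by rewrite (inj_eq (@complexI _)) gt_eqF.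
  apply: (scalerI s0'); rewrite -smulZl -smulZr.
  have -> : (s%:C)%C *: D = Y + Y - Y ** Y by rewrite YE addrK.
  by rewrite smulBl smulBr smulDl smulDr smulA.
have Dh : D ** h = h ** D by rewrite /h (smulBr D sone Y) (smulBl sone Y D) DY smul1 smulr1.
have DZ : Z ** D = D ** Z.
  have := congr1 (fun u => Z ** u ** Z) Dh.
  by rewrite !smulA Zh smul1 -smulA hZ smulr1.
have VD : V ** D = (s%:C)%C *: (D ** V).
  by rewrite /V -smulA TD smulZr smulA DZ smulA.
have VkD k : spow V k ** D = ((s ^+ k)%:C)%C *: (D ** spow V k).
  elim: k => [|k IH] /=; first by rewrite scale1r smul1 smulr1.
  rewrite -smulA IH smulZr smulA VD smulZl scalerA -rmorphM /= -exprSr.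
  by rewrite -smulA.
pose P : A := sone - star V ** V.
have PV : P ** star V = 0 by rewrite /P smulBl smul1 -smulA VV smulr1 subrr.
have PD : P ** D = P by rewrite smulBr smulr1 [X in P ** (X ** _)]TV !smulA PV !smul0l subr0.
have Vk1 k : rnorm (spow V k) <= 1 by apply/rnorm_spow/rnorm_coisometry.
exists V, h; split=> //; first by rewrite /h starB star1 sY.
- move=> k; rewrite -/P; set z := P ** spow V k.
  set t := Num.sqrt (1 - s ^+ k.+1).
  have t0 : 0 <= t by apply: sqrtr_ge0.
  have tt : t * t = 1 - s ^+ k.+1.
    by rewrite -expr2 sqr_sqrtr // subr_ge0 exprn_ile1 // ltW.
  have zD : z ** D = ((s ^+ k)%:C)%C *: z.
    by rewrite /z -smulA VkD smulZr smulA PD.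
  have zhh : z ** h ** h = ((t * t)%:C)%C *: z.
    rewrite -smulA hh TT smulBr smulr1 smulZr zD scalerA -rmorphM /= -exprS tt.
    by rewrite rmorphB /= scalerBl scale1r.
  (* z' (h + t) = 0 where h + t = 1 + t - Y, and |Y| < 1 forces z' = 0. *)
  pose z' := z ** h - (t%:C)%C *: z.
  have z'Y : ((1 + t)%:C)%C *: z' = z' ** Y.
    have : z' ** h + (t%:C)%C *: z' = 0.
      rewrite /z' smulBl zhh smulZl scalerBr scalerA -rmorphM /=.
      by rewrite addrA subrK subrr.
    rewrite {1}/h smulBr smulr1 rmorphD /= scalerDl scale1r => /eqP.
    by rewrite addrAC subr_eq0 => /eqP.
  have : rnorm z' = 0.
    have := rnormM z' Y; rewrite -z'Y rnormZr ger0_norm ?addr_ge0 //.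
    have := rnorm_ge0 z'; move: (rnorm z') => d d0 hd.
    have : d * rnorm Y <= d * s by apply: ler_wpM2l.
    by move=> hd'; apply/eqP; rewrite eq_le d0 andbT; nra.
  by move=> /rnorm0_eq0/eqP; rewrite subr_eq0 => /eqP.
- move=> k; rewrite /h opprB addrC subrK.
  (* Multiplying Y + Y = s D + Y Y by V^k on the left bounds |V^k Y| by s^(k+1). *)
  have dbl (u : A) : u + u = ((1 + 1 : R)%:C)%C *: u.
    by rewrite rmorphD /= scalerDl scale1r.
  have uE : spow V k ** Y + spow V k ** Y =
      ((s ^+ k.+1)%:C)%C *: (D ** spow V k) + spow V k ** Y ** Y.
    by rewrite -smulDr YE smulDr smulZr VkD scalerA -rmorphM -exprS smulA.
  have := rnormD (((s ^+ k.+1)%:C)%C *: (D ** spow V k)) (spow V k ** Y ** Y).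
  rewrite -uE dbl !rnormZr => h1.
  have h6 : 0 <= s ^+ k.+1 by rewrite exprn_ge0 // ltW.
  rewrite (ger0_norm h6) (@ger0_norm _ (1 + 1)) ?addr_ge0 // in h1.
  have h2 : rnorm (D ** spow V k) <= 1.
    by rewrite (le_trans (rnormM _ _)) // mulr_ile1 ?rnorm_ge0.
  have h3 := rnormM (spow V k ** Y) Y.
  have h4 := rnorm_ge0 (spow V k ** Y).
  have h5 := ler_wpM2l h4 Ys.
  have h7 := ler_wpM2l h6 h2.
  move: h1 h3 h4 h5 h6 h7; move: (rnorm _) (s ^+ k.+1) => y sk.
  move: (rnorm _) (rnorm _) (rnorm _) => a b c.
  nra.
Qed.
End DiscPolar.

(** * Asymptotic intertwiners in a Hilbert-Schmidt space *)

Section HilbertSchmidt.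
Variables (R : realType).
Local Notation C := (Cfield R).
Variables (H K : hilbertType C) (e : nat -> H).
Hypothesis e_on : forall n, orthonormal n e.

(** The vector sum_k w_k (x) e_k of the tensor product of K and H, seen as a
conjugate-linear map from K to H: operators on H act by composition, and the
square of its Hilbert-Schmidt norm is the supremum over all finite orthonormal
families u of the sums of the |hsmap m w (u i)|^2. *)
Definition hsmap m (w : nat -> K) (u : K) : H := \sum_(k < m) inner (w k) u *: e k.

Lemma rnorm_sqD (x y : H) :
  rnorm (x + y) ^+ 2 <= 2 * rnorm x ^+ 2 + 2 * rnorm y ^+ 2.
Proof.
have h : rnorm (x + y) ^+ 2 <= (rnorm x + rnorm y) ^+ 2.
  by rewrite ler_sqr ?nnegrE ?addr_ge0 ?rnorm_ge0 // rnormD.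
by have := sqr_ge0 (rnorm x - rnorm y); rewrite sqrrB; rewrite sqrrD in h; lra.
Qed.

Lemma hsmap_sq m w u : rnorm (hsmap m w u) ^+ 2 = \sum_(k < m) cabs (inner (w k) u) ^+ 2.
Proof. exact: (rnorm_orthonormal_sum (fun k => inner (w k) u) (e_on (n := m))). Qed.

Lemma hsmap_le m w r u : orthonormal r u ->
  \sum_(i < r) rnorm (hsmap m w (u i)) ^+ 2 <= \sum_(k < m) rnorm (w k) ^+ 2.
Proof.
move=> ou; under eq_bigr do rewrite hsmap_sq.
by rewrite exchange_big; apply: ler_sum => k _; apply: bessel.
Qed.

Lemma hsmap_eq m w r u : orthonormal r u ->
  (forall k, (k < m)%N -> w k = oproj r u (w k)) ->
  \sum_(i < r) rnorm (hsmap m w (u i)) ^+ 2 = \sum_(k < m) rnorm (w k) ^+ 2.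
Proof.
move=> ou wu; under eq_bigr do rewrite hsmap_sq.
by rewrite exchange_big; apply: eq_bigr => k _; apply: bessel_eq => //; apply: wu.
Qed.

Lemma hsmapB m w w' u : hsmap m w u - hsmap m w' u = hsmap m (fun k => w k - w' k) u.
Proof.
rewrite /hsmap -sumrB; apply: eq_bigr => k _.
by rewrite -scalerBl innerBl.
Qed.

Lemma hsmap_widen m w u : w m = 0 -> hsmap m.+1 w u = hsmap m w u.
Proof. by move=> wm; rewrite /hsmap big_ord_recr /= wm inner0l scale0r addr0. Qed.

Section Intertwiner.
Variables (A : starAlgType C) (rho : A -> H -> H) (pi : A -> K -> K).
Hypotheses (hrho : is_star_rep rho) (hpi : is_star_rep pi).
Variables (V : nat -> K -> nat -> K).
Hypothesis V_linear : forall N c v v' k, V N (c *: v + v') k = c *: V N v k + V N v' k.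

Definition defect p N v u :=
  rho p (hsmap N (V N v) u) - hsmap N (V N (pi p v)) u.

(** Up to an error that vanishes in Hilbert-Schmidt norm when N grows, the maps
v |-> hsmap N (V N v) carry pi p to the action of rho p. *)
Definition intertwines p := forall v (eps : R), 0 < eps ->
  exists N0, forall N, (N0 <= N)%N -> forall r u, orthonormal r u ->
    \sum_(i < r) rnorm (defect p N v (u i)) ^+ 2 <= eps.

Lemma hsmapVl N c v v' u : hsmap N (V N (c *: v + v')) u =
  c *: hsmap N (V N v) u + hsmap N (V N v') u.
Proof.
rewrite /hsmap scaler_sumr -big_split /=; apply: eq_bigr => k _.
by rewrite V_linear innerD innerZ scalerDl scalerA.
Qed.

Lemma hsmapV0 N u : hsmap N (V N 0) u = 0.
Proof.
have := hsmapVl N (-1) 0 0 u; rewrite addr0 scaler0 scaleN1r => {1}->.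
by rewrite addNr.
Qed.

Lemma intertwines1 : intertwines sone.
Proof.
move=> v eps e0; exists 0%N => N _ r u _; rewrite big1 ?ltW // => i _.
by rewrite /defect (rep1 hrho) (rep1 hpi) subrr rnorm0 expr0n.
Qed.

Lemma intertwinesZ c p : intertwines p -> intertwines (c *: p).
Proof.
move=> hp v eps e0.
have c1 : 0 < 1 + cabs c ^+ 2 by rewrite ltr_pwDl // sqr_ge0.
have [N0 h] := hp v _ (divr_gt0 e0 c1); exists N0 => N NN r u ou.
have E i : rnorm (defect (c *: p) N v (u i)) ^+ 2 =
    cabs c ^+ 2 * rnorm (defect p N v (u i)) ^+ 2.
  rewrite /defect (repZ hrho) (repZ hpi) -[c *: pi p v]addr0 hsmapVl hsmapV0 addr0.
  by rewrite -scalerBr rnormZ exprMn.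
under eq_bigr do rewrite E.
rewrite -mulr_sumr; have h1 := h N NN r u ou; rewrite ler_pdivlMr // mulrDr mulr1 in h1.
rewrite mulrC (le_trans _ h1) // lerDr.
by apply: sumr_ge0 => i _; rewrite sqr_ge0.
Qed.

Lemma intertwinesD p q : intertwines p -> intertwines q -> intertwines (p + q).
Proof.
move=> hp hq v eps e0; have e4 : 0 < eps / 4 by rewrite divr_gt0.
have [N1 h1] := hp v _ e4; have [N2 h2] := hq v _ e4.
exists (maxn N1 N2) => N; rewrite geq_max => /andP[NN1 NN2] r u ou.
have E i : rnorm (defect (p + q) N v (u i)) ^+ 2 <=
    2 * rnorm (defect p N v (u i)) ^+ 2 + 2 * rnorm (defect q N v (u i)) ^+ 2.
  rewrite (le_trans _ (rnorm_sqD _ _)) // /defect (repD hrho) (repD hpi).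
  by rewrite -[pi p v]scale1r hsmapVl !scale1r opprD addrACA.
apply: le_trans; first by apply: ler_sum => i _; exact: E.
rewrite big_split /= -!mulr_sumr.
have := h1 N NN1 r u ou; have := h2 N NN2 r u ou.
by move: (\sum_(i < r) _) (\sum_(i < r) _) => a b; lra.
Qed.

Lemma intertwinesM p q : intertwines p -> intertwines q -> intertwines (p ** q).
Proof.
move=> hp hq v eps e0; have [M M0 hM] := rep_rbound hrho p.
have M1 : 0 < 1 + M ^+ 2 by rewrite ltr_pwDl // sqr_ge0.
have e4 : 0 < eps / 4 by rewrite divr_gt0.
have [N1 h1] := hp (pi q v) _ e4; have [N2 h2] := hq v _ (divr_gt0 e4 M1).
exists (maxn N1 N2) => N; rewrite geq_max => /andP[NN1 NN2] r u ou.
have E i : rnorm (defect (p ** q) N v (u i)) ^+ 2 <=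
    2 * rnorm (defect p N (pi q v) (u i)) ^+ 2 +
    2 * (M ^+ 2 * rnorm (defect q N v (u i)) ^+ 2).
  (* The defect of p at pi q v, plus the image under rho p of the defect of q. *)
  have -> : defect (p ** q) N v (u i) =
      defect p N (pi q v) (u i) + rho p (defect q N v (u i)).
    rewrite /defect (repM hrho) (repM hpi) (rep_xB hrho).
    by rewrite [RHS]addrC addrA subrK.
  apply: le_trans (rnorm_sqD _ _) _; rewrite lerD2l ler_pM2l // -exprMn.
  by rewrite ler_sqr ?nnegrE ?mulr_ge0 ?rnorm_ge0.
apply: le_trans; first by apply: ler_sum => i _; exact: E.
rewrite big_split /= -!mulr_sumr.
have := h1 N NN1 r u ou; have := h2 N NN2 r u ou; rewrite ler_pdivlMr //.
have : 0 <= \sum_(i < r) rnorm (defect q N v (u i)) ^+ 2.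
  by apply: sumr_ge0 => i _; rewrite sqr_ge0.
move: (\sum_(i < r) _) (\sum_(i < r) _) => a b; move: (M ^+ 2) => m; nra.
Qed.

(** An orthonormal family u spanning the vectors V N (pi p v) k computes the norm
of hsmap N (V N (pi p v)) exactly, and rho p is applied to each
hsmap N (V N v) (u i). The factor 2 comes from |a + b|^2 <= 2 |a|^2 + 2 |b|^2;
the applications are insensitive to constants. *)
Lemma intertwines_bound p (M : R) : intertwines p ->
  (forall x, rnorm (rho p x) <= M * rnorm x) -> forall v (eps : R), 0 < eps ->
  exists N0, forall N, (N0 <= N)%N ->
    \sum_(k < N) rnorm (V N (pi p v) k) ^+ 2 <=
    2 * M ^+ 2 * (\sum_(k < N) rnorm (V N v k) ^+ 2) + eps.
Proof.
move=> hp hM v eps e0; have e2 : 0 < eps / 2 by rewrite divr_gt0.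
have [N0 h] := hp v _ e2; exists N0 => N NN.
have [r [u [ou wu]]] := orthonormal_span N (V N (pi p v)).
rewrite -(hsmap_eq ou wu).
have E i : rnorm (hsmap N (V N (pi p v)) (u i)) ^+ 2 <=
    2 * (M ^+ 2 * rnorm (hsmap N (V N v) (u i)) ^+ 2) +
    2 * rnorm (defect p N v (u i)) ^+ 2.
  have -> : hsmap N (V N (pi p v)) (u i) =
      rho p (hsmap N (V N v) (u i)) + - defect p N v (u i).
    by rewrite /defect opprB addrC subrK.
  apply: le_trans (rnorm_sqD _ _) _; rewrite rnormN lerD2r ler_pM2l // -exprMn.
  have := hM (hsmap N (V N v) (u i)); have := rnorm_ge0 (rho p (hsmap N (V N v) (u i))).
  by move=> a0 ab; rewrite ler_sqr ?nnegrE // (le_trans a0).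
apply: le_trans; first by apply: ler_sum => i _; exact: E.
rewrite big_split /= -!mulr_sumr.
have := h N NN r u ou; have := ler_wpM2l (sqr_ge0 M) (hsmap_le N (V N v) ou).
rewrite -[2 * M ^+ 2 * _]mulrA.
by move: (\sum_(i < r) _) (M ^+ 2 * _) (M ^+ 2 * _) => a b c; lra.
Qed.

Section Shift.
Variables (T : A) (t : nat -> R).
Hypothesis rhoT : forall k, rho T (e k) = ((t k)%:C)%C *: e k.+1.
Hypothesis rhoTs0 : rho (star T) (e 0%N) = 0.
Hypothesis rhoTs : forall k, rho (star T) (e k.+1) = ((t k)%:C)%C *: e k.
Hypothesis V_support : forall N v, V N v N = 0.

Lemma hsmap_shift m w u : rho T (hsmap m w u) =
  hsmap m.+1 (fun k => if k is j.+1 then ((t j)%:C)%C *: w j else 0) u.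
Proof.
rewrite /hsmap (rep_xsum hrho _ _ (fun k => inner (w k) u *: e k)).
rewrite big_ord_recl inner0l scale0r add0r; apply: eq_bigr => k _.
by rewrite (rep_xZ hrho) rhoT /= innerZ scalerA mulrC.
Qed.

Lemma hsmap_unshift m w u : rho (star T) (hsmap m.+1 w u) =
  hsmap m (fun k => ((t k)%:C)%C *: w k.+1) u.
Proof.
rewrite /hsmap (rep_xsum hrho _ _ (fun k => inner (w k) u *: e k)).
rewrite big_ord_recl (rep_xZ hrho) rhoTs0 scaler0 add0r; apply: eq_bigr => k _.
by rewrite (rep_xZ hrho) rhoTs /= innerZ scalerA mulrC.
Qed.

Lemma intertwines_shift :
  (forall v (eps : R), 0 < eps -> exists N0, forall N, (N0 <= N)%N ->
    rnorm (V N (pi T v) 0%N) ^+ 2 + \sum_(k < N)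
      rnorm (((t k)%:C)%C *: V N v k - V N (pi T v) k.+1) ^+ 2 <= eps) ->
  intertwines T.
Proof.
move=> h v eps e0; have [N0 hN] := h v _ e0; exists N0 => N NN r u ou.
have E x : defect T N v x = hsmap N.+1 (fun k =>
    (if k is j.+1 then ((t j)%:C)%C *: V N v j else 0) - V N (pi T v) k) x.
  by rewrite /defect hsmap_shift -(hsmap_widen _ (V_support N (pi T v))) hsmapB.
under eq_bigr do rewrite E.
apply: le_trans (hsmap_le _ _ ou) _; apply: le_trans (hN N NN).
by rewrite big_ord_recl /= sub0r rnormN lerD2l.
Qed.

Lemma intertwines_unshift :
  (forall v (eps : R), 0 < eps -> exists N0, forall N, (N0 <= N)%N ->
    \sum_(k < N) rnorm (((t k)%:C)%C *: V N v k.+1 - V N (pi (star T) v) k) ^+ 2 <= eps) ->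
  intertwines (star T).
Proof.
move=> h v eps e0; have [N0 hN] := h v _ e0; exists N0 => N NN r u ou.
have E x : defect (star T) N v x = hsmap N (fun k =>
    ((t k)%:C)%C *: V N v k.+1 - V N (pi (star T) v) k) x.
  by rewrite /defect -(hsmap_widen _ (V_support N v)) hsmap_unshift hsmapB.
under eq_bigr do rewrite E.
exact: le_trans (hsmap_le _ _ ou) (hN N NN).
Qed.
End Shift.
End Intertwiner.
End HilbertSchmidt.

(** * Every representation of the disc is bounded by the Fock representation *)

Section Toeplitz.
Variables (R : realType).
Local Notation C := (Cfield R).

Lemma nonincreasing_gap (b : nat -> R) (eps : R) : (forall n, 0 <= b n) ->
  (forall n, b n.+1 <= b n) -> 0 < eps ->
  exists N0, forall N, (N0 <= N)%N -> b N - b N.+1 <= eps.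
Proof.
move=> b0 bS e0.
have /cvgrPdist_lt /(_ _ (divr_gt0 e0 (ltr0Sn _ 1))) [N0 _ h] : cvgn b.
  apply: nonincreasing_is_cvgn; first exact/nonincreasing_seqP.
  by exists 0 => _ [n _ <-].
exists N0 => N NN; have := h N NN; have := h N.+1 (leq_trans NN (leqnSn _)).
by rewrite /= !ltr_norml => /andP[h1 h2] /andP[h3 h4]; lra.
Qed.

Lemma inv_nat_small (D eps : R) : 0 <= D -> 0 < eps ->
  exists N0, forall N, (N0 <= N)%N -> N%:R^-1 * D <= eps.
Proof.
move=> D0 e0; exists (Num.Def.archi_bound (D / eps)).+1 => N NN.
have N0 : 0 < N%:R :> R by rewrite ltr0n (leq_trans _ NN).
rewrite mulrC ler_pdivrMr // mulrC -ler_pdivrMr //.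
have h := archi_boundP (divr_ge0 D0 (ltW e0)).
by rewrite (le_trans (ltW h)) // ler_nat ltnW.
Qed.

Lemma geometric_sum_le (s : R) n : 0 <= s < 1 -> \sum_(k < n) s ^+ k <= (1 - s)^-1.
Proof.
move=> /andP[s0 s1]; have s1' : 0 < 1 - s by rewrite subr_gt0.
rewrite -[X in _ <= X]mul1r ler_pdivlMr // mulrC.
suff -> : (1 - s) * (\sum_(k < n) s ^+ k) = 1 - s ^+ n by rewrite gerBl exprn_ge0.
elim: n => [|n IH]; first by rewrite big_ord0 mulr0 subrr.
by rewrite big_ord_recr /= mulrDr IH exprS; ring.
Qed.

Variables (s : R) (s01 : 0 < s < 1).
(** The coefficients of the Fock representation of the disc algebra. *)
Definition weight k : R := Num.sqrt (1 - s ^+ k.+1).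

Lemma weight_ge0 k : 0 <= weight k. Proof. exact: sqrtr_ge0. Qed.

Lemma pow_s_ge0 k : 0 <= s ^+ k.
Proof. by rewrite exprn_ge0 //; case/andP: s01 => /ltW. Qed.

Lemma pow_s_le1 k : s ^+ k <= 1.
Proof. by case/andP: s01 => /ltW s0 /ltW s1; rewrite exprn_ile1. Qed.

Lemma weight_sq k : weight k ^+ 2 = 1 - s ^+ k.+1.
Proof. by rewrite sqr_sqrtr // subr_ge0 pow_s_le1. Qed.

Lemma weight_le1 k : weight k <= 1.
Proof.
have := weight_sq k; have := pow_s_ge0 k.+1; have := weight_ge0 k.
by move: (weight k) (s ^+ _) => x y; nra.
Qed.

Lemma weight_gap k : `|1 - weight k| <= s ^+ k.+1.
Proof.
rewrite ger0_norm ?subr_ge0 ?weight_le1 //.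
have := weight_sq k; have := weight_le1 k; have := weight_ge0 k.
by move: (weight k) (s ^+ _) => x y; nra.
Qed.

Variables (A : cstarAlgType C) (T V h : A).
Hypothesis VV : V ** star V = sone.
Hypothesis TVh : T = star V ** h.
Hypothesis sh : star h = h.
Local Notation P := (sone - star V ** V).
Hypothesis PVh : forall k, P ** spow V k ** h = ((weight k)%:C)%C *: (P ** spow V k).
Hypothesis Vh : forall k, rnorm (spow V k ** (sone - h)) <= s ^+ k.+1.

Variables (H K : hilbertType C) (e : nat -> H).
Hypothesis e_on : forall n, orthonormal n e.
Variables (rho : A -> H -> H) (pi : A -> K -> K).
Hypotheses (hrho : is_star_rep rho) (hpi : is_star_rep pi).
Hypothesis rhoT : forall k, rho T (e k) = ((weight k)%:C)%C *: e k.+1.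
Hypothesis rhoTs0 : rho (star T) (e 0%N) = 0.
Hypothesis rhoTs : forall k, rho (star T) (e k.+1) = ((weight k)%:C)%C *: e k.

Let V1 : rnorm V <= 1. Proof. exact: rnorm_coisometry. Qed.

Lemma rnorm_spow_rep k v : rnorm (pi (spow V k) v) <= rnorm v.
Proof.
apply: le_trans (rep_contractive hpi _ _) _.
by rewrite ler_piMl ?rnorm_ge0 // rnorm_spow.
Qed.

Lemma spowS_T k : spow V k.+1 ** T = spow V k ** h.
Proof. by rewrite TVh /= -spow_comm -smulA (smulA V) VV smul1. Qed.

Lemma starT : star T = h ** V.
Proof. by rewrite TVh starM starK sh. Qed.

Lemma PT0 : P ** T = 0.
Proof. by rewrite TVh smulA smulBl smul1 -smulA VV smulr1 subrr smul0l. Qed.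

(** The vector sum_(k < N) c_N e_k (x) X V^k v. For X = 1 - V^* V it sees the part
of K on which pi is a multiple of the Fock representation, for X = 1 it sees
also the part on which V is unitary. *)
Definition window (X : A) (c : nat -> R) N v k : K :=
  if (k < N)%N then ((c N)%:C)%C *: pi (X ** spow V k) v else 0.

Lemma window_linear X c N a v v' k :
  window X c N (a *: v + v') k = a *: window X c N v k + window X c N v' k.
Proof.
rewrite /window; case: ifP => _; last by rewrite scaler0 addr0.
by rewrite (rep_xD hpi) (rep_xZ hpi) scalerDr !scalerA mulrC.
Qed.

Lemma window_support X c N v : window X c N v N = 0.
Proof. by rewrite /window ltnn. Qed.

Lemma rnorm_P x : rnorm (pi P x) ^+ 2 = rnorm x ^+ 2 - rnorm (pi V x) ^+ 2.
Proof.
have PP : star P ** P = P.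
  rewrite starB star1 starM starK smulBl smul1 smulBr smulr1 -smulA.
  by rewrite (smulA V) VV smul1 subrr subr0.
apply: complexI; rewrite (rnorm_rep_star_mul hpi) PP (repB hpi) (rep1 hpi) innerBl.
by rewrite -(rnorm_rep_star_mul hpi) inner_rnorm rmorphB.
Qed.

Lemma rnorm_P_spow k v : rnorm (pi (P ** spow V k) v) ^+ 2 =
  rnorm (pi (spow V k) v) ^+ 2 - rnorm (pi (spow V k.+1) v) ^+ 2.
Proof. by rewrite (repM hpi) rnorm_P -(repM hpi). Qed.

Lemma rnorm_spowS_le k v :
  rnorm (pi (spow V k.+1) v) ^+ 2 <= rnorm (pi (spow V k) v) ^+ 2.
Proof. by rewrite -subr_ge0 -rnorm_P_spow sqr_ge0. Qed.

(** The |V^k v|^2 decrease, and |P V^k v|^2 is their k-th decrement. *)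
Lemma P_spow_small v (eps : R) : 0 < eps -> exists N0, forall N, (N0 <= N)%N ->
  rnorm (pi (P ** spow V N) v) ^+ 2 <= eps.
Proof.
move=> e0.
have [|k|N0 hN] := @nonincreasing_gap (fun k => rnorm (pi (spow V k) v) ^+ 2) eps _ _ e0.
- by move=> n; apply: sqr_ge0.
- exact: rnorm_spowS_le.
- by exists N0 => N NN; rewrite rnorm_P_spow hN.
Qed.

(** V^k h and (weight k) V^k are both close to V^k. *)
Let weight_commute k x :
  rnorm (((weight k)%:C)%C *: pi (spow V k) x - pi (spow V k ** h) x) <=
  2 * s ^+ k.+1 * rnorm x.
Proof.
have -> : ((weight k)%:C)%C *: pi (spow V k) x - pi (spow V k ** h) x =
    pi (spow V k ** (sone - h)) x - ((1 - weight k)%:C)%C *: pi (spow V k) x.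
  rewrite smulBr smulr1 (repB hpi) rmorphB /= scalerBl scale1r opprB.
  by rewrite [RHS]addrC addrA subrK.
apply: le_trans (rnormB _ _) _; rewrite rnormZr.
have h1 := rep_contractive hpi (spow V k ** (sone - h)) x.
have h2 := ler_wpM2r (rnorm_ge0 x) (Vh k).
have h3 := ler_pM (normr_ge0 _) (rnorm_ge0 _) (weight_gap k) (rnorm_spow_rep k x).
rewrite -mulrA mulr_natl mulr2n; apply: lerD h3; exact: le_trans h1 h2.
Qed.

Let sum_defect n x : \sum_(k < n)
    rnorm (((weight k)%:C)%C *: pi (spow V k) x - pi (spow V k ** h) x) ^+ 2 <=
  4 * rnorm x ^+ 2 / (1 - s).
Proof.
have E k : rnorm (((weight k)%:C)%C *: pi (spow V k) x - pi (spow V k ** h) x) ^+ 2 <=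
    4 * rnorm x ^+ 2 * s ^+ k.
  have h1 : rnorm (((weight k)%:C)%C *: pi (spow V k) x - pi (spow V k ** h) x) ^+ 2
      <= (2 * s ^+ k.+1 * rnorm x) ^+ 2.
    by rewrite ler_sqr ?nnegrE ?mulr_ge0 ?rnorm_ge0 ?pow_s_ge0 // weight_commute.
  apply: (le_trans h1).
  have -> : (2 * s ^+ k.+1 * rnorm x) ^+ 2 = 4 * rnorm x ^+ 2 * s ^+ k.+1 ^+ 2 by ring.
  apply: ler_wpM2l; first by rewrite mulr_ge0 ?sqr_ge0.
  rewrite -exprM.
  have -> : (k.+1 * 2 = k + k.+2)%N by lia.
  by rewrite exprD ler_piMr ?pow_s_ge0 ?pow_s_le1.
apply: le_trans; first by apply: ler_sum => i _; exact: E.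
rewrite -mulr_sumr; apply: ler_wpM2l; first by rewrite mulr_ge0 ?sqr_ge0.
by apply: geometric_sum_le; case/andP: s01 => /ltW -> ->.
Qed.

(** Since P V^k h = (weight k) P V^k, the only defect is at the end of the window,
where it is controlled by P_spow_small. *)
Lemma vacuum_intertwines_T : intertwines e rho pi (window P (fun=> 1)) T.
Proof.
apply: (intertwines_shift e_on hrho rhoT); first exact: window_support.
move=> v eps e0; have [N0 hN] := P_spow_small v e0.
exists N0.+1 => -[|N] // NN.
rewrite {1}/window ltn0Sn /= smulr1 -(repM hpi) PT0 (rep0 hpi) scaler0 rnorm0.
rewrite expr0n add0r big_ord_recr big1 ?add0r /=; last first.
  move=> k _; rewrite /window ltnS ltnW ?ltn_ord // ltnS ltn_ord !scale1r.
  rewrite -(repM hpi) -smulA spowS_T smulA PVh (repZ hpi) subrr rnorm0.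
  by rewrite expr0n.
rewrite {2}/window ltnn subr0 /window ltnSn scale1r rnormZr exprMn.
rewrite (ger0_norm (weight_ge0 _)) weight_sq (le_trans _ (hN N NN)) //.
by rewrite ?add0r ler_piMl ?sqr_ge0 // gerBl pow_s_ge0.
Qed.

Lemma vacuum_intertwines_starT : intertwines e rho pi (window P (fun=> 1)) (star T).
Proof.
apply: (intertwines_unshift e_on hrho rhoTs0 rhoTs); first exact: window_support.
move=> v eps e0; have [N0 hN] := P_spow_small v e0.
exists N0.+1 => -[|N] // NN.
have PVk k : pi (P ** spow V k) (pi (star T) v) =
    ((weight k)%:C)%C *: pi (P ** spow V k.+1) v.
  by rewrite -(repM hpi) starT smulA PVh smulZl (repZ hpi) -smulA spow_comm.
rewrite big_ord_recr big1 ?add0r /=; last first.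
  move=> k _; rewrite /window ltnS ltn_ord ltnS ltnW ?ltn_ord // !scale1r.
  by rewrite PVk subrr rnorm0 expr0n.
rewrite {1}/window ltnn scaler0 sub0r rnormN /window ltnSn scale1r PVk rnormZr exprMn.
rewrite (ger0_norm (weight_ge0 _)) weight_sq (le_trans _ (hN N.+1 (leqW NN))) //.
by rewrite ?add0r ler_piMl ?sqr_ge0 // gerBl pow_s_ge0.
Qed.

(** The height that makes the constant sequence on k < N a unit vector. *)
Definition flat_height N : R := (Num.sqrt N%:R)^-1.

Let flat_ge0 N : 0 <= flat_height N. Proof. by rewrite invr_ge0 sqrtr_ge0. Qed.
Let flat_sq N : flat_height N ^+ 2 = N%:R^-1. Proof. by rewrite exprVn sqr_sqrtr. Qed.

Let s1' : 0 < 1 - s. Proof. by rewrite subr_gt0; case/andP: s01. Qed.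

Let flat_bound_ge0 (x : K) : 0 <= 4 * rnorm x ^+ 2 / (1 - s).
Proof. by rewrite divr_ge0 ?(ltW s1') // mulr_ge0 ?sqr_ge0. Qed.

(** Each of the two ends of the window contributes O(1/N) to the squared defect;
inside, the squared defects are 1/N times the terms of a convergent series. *)
Lemma flat_intertwines_T : intertwines e rho pi (window sone flat_height) T.
Proof.
apply: (intertwines_shift e_on hrho rhoT); first exact: window_support.
move=> v eps e0.
pose D := rnorm (pi T v) ^+ 2 + (4 * rnorm v ^+ 2 / (1 - s) + rnorm v ^+ 2).
have D0 : 0 <= D by rewrite /D !addr_ge0 ?flat_bound_ge0 ?sqr_ge0.
have [N0 hN] := inv_nat_small D0 e0.
exists N0.+1 => -[|N] // NN; apply: le_trans (hN _ (ltnW NN)).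
rewrite -flat_sq /D 2!mulrDr; apply: lerD.
  by rewrite /window ltn0Sn /= smul1 (rep1 hpi) rnormZr (ger0_norm (flat_ge0 _)) exprMn.
rewrite big_ord_recr /=; apply: lerD.
  have E (k : 'I_N) : rnorm (((weight k)%:C)%C *: window sone flat_height N.+1 v k -
      window sone flat_height N.+1 (pi T v) k.+1) ^+ 2 = flat_height N.+1 ^+ 2 *
      rnorm (((weight k)%:C)%C *: pi (spow V k) v - pi (spow V k ** h) v) ^+ 2.
    rewrite /window ltnS ltnW ?ltn_ord // ltnS ltn_ord !smul1.
    rewrite -(repM hpi) spowS_T scalerA mulrC -scalerA -scalerBr.
    by rewrite rnormZr (ger0_norm (flat_ge0 _)) exprMn.
  under eq_bigr do rewrite E.
  by rewrite -mulr_sumr ler_wpM2l ?sqr_ge0 // sum_defect.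
rewrite {2}/window ltnn subr0 /window ltnSn smul1 scalerA mulrC -scalerA rnormZr.
rewrite (ger0_norm (flat_ge0 _)) exprMn ler_wpM2l ?sqr_ge0 //.
rewrite rnormZr (ger0_norm (weight_ge0 _)) ler_sqr ?nnegrE ?mulr_ge0 ?weight_ge0 ?rnorm_ge0 //.
by rewrite -[X in _ <= X]mul1r ler_pM ?weight_ge0 ?rnorm_ge0 ?weight_le1 ?rnorm_spow_rep.
Qed.

Lemma flat_intertwines_starT : intertwines e rho pi (window sone flat_height) (star T).
Proof.
apply: (intertwines_unshift e_on hrho rhoTs0 rhoTs); first exact: window_support.
move=> v eps e0; pose x := pi V v.
pose D := 4 * rnorm x ^+ 2 / (1 - s) + rnorm (pi h x) ^+ 2.
have D0 : 0 <= D by rewrite /D !addr_ge0 ?flat_bound_ge0 ?sqr_ge0.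
have [N0 hN] := inv_nat_small D0 e0.
exists N0.+1 => -[|N] // NN; apply: le_trans (hN _ (ltnW NN)).
have Tx : pi (star T) v = pi h x by rewrite starT (repM hpi).
rewrite -flat_sq /D mulrDr big_ord_recr /=; apply: lerD.
  have E (k : 'I_N) : rnorm (((weight k)%:C)%C *: window sone flat_height N.+1 v k.+1 -
      window sone flat_height N.+1 (pi (star T) v) k) ^+ 2 = flat_height N.+1 ^+ 2 *
      rnorm (((weight k)%:C)%C *: pi (spow V k) x - pi (spow V k ** h) x) ^+ 2.
    rewrite /window ltnS ltn_ord ltnS ltnW ?ltn_ord // !smul1 Tx.
    have -> : pi (spow V k.+1) v = pi (spow V k) x by rewrite /= -spow_comm (repM hpi).
    rewrite -(repM hpi (spow V k) h).
    rewrite scalerA mulrC -scalerA -scalerBr.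
    by rewrite rnormZr (ger0_norm (flat_ge0 _)) exprMn.
  under eq_bigr do rewrite E.
  by rewrite -mulr_sumr ler_wpM2l ?sqr_ge0 // sum_defect.
rewrite {1}/window ltnn scaler0 sub0r rnormN /window ltnSn smul1 Tx rnormZr.
rewrite (ger0_norm (flat_ge0 _)) exprMn ler_wpM2l ?sqr_ge0 //.
by rewrite ler_sqr ?nnegrE ?rnorm_ge0 // rnorm_spow_rep.
Qed.

Lemma window_vacuum_sum N v : \sum_(k < N) rnorm (window P (fun=> 1) N v k) ^+ 2 =
  rnorm v ^+ 2 - rnorm (pi (spow V N) v) ^+ 2.
Proof.
have E (k : 'I_N) : rnorm (window P (fun=> 1) N v k) ^+ 2 =
    rnorm (pi (spow V k) v) ^+ 2 - rnorm (pi (spow V k.+1) v) ^+ 2.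
  by rewrite /window ltn_ord scale1r rnorm_P_spow.
under eq_bigr do rewrite E.
elim: N {E} => [|N IH]; first by rewrite big_ord0 (rep1 hpi) subrr.
by rewrite big_ord_recr /= IH addrA subrK.
Qed.

Lemma window_flat_sum N v : (0 < N)%N ->
  rnorm (pi (spow V N) v) ^+ 2 <= \sum_(k < N) rnorm (window sone flat_height N v k) ^+ 2 <=
  rnorm v ^+ 2.
Proof.
move=> N0.
have E (k : 'I_N) : rnorm (window sone flat_height N v k) ^+ 2 =
    N%:R^-1 * rnorm (pi (spow V k) v) ^+ 2.
  by rewrite /window ltn_ord smul1 rnormZr (ger0_norm (flat_ge0 _)) exprMn flat_sq.
under eq_bigr do rewrite E.
have Np : 0 < N%:R :> R by rewrite ltr0n.
rewrite -mulr_sumr ler_pdivlMl // ler_pdivrMl //.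
have sumc (x : R) : N%:R * x = \sum_(k < N) x.
  by rewrite sumr_const card_ord mulr_natl.
rewrite !sumc; apply/andP; split; apply: ler_sum => k _.
  have mono a b : (a <= b)%N ->
      rnorm (pi (spow V b) v) ^+ 2 <= rnorm (pi (spow V a) v) ^+ 2.
    move=> /subnKC <-; elim: (b - a)%N => [|m IH]; first by rewrite addn0.
    by rewrite addnS (le_trans (rnorm_spowS_le _ _)).
  exact/mono/ltnW/ltn_ord.
by rewrite ler_sqr ?nnegrE ?rnorm_ge0 // rnorm_spow_rep.
Qed.

(** The two windows have squared norms |v|^2 - |V^N v|^2 and the mean of the
|V^k v|^2 over k < N, which add up to a number between |v|^2 and 2 |v|^2. *)
Lemma toeplitz_domination p (M : R) : 0 <= M ->
  intertwines e rho pi (window P (fun=> 1)) p ->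
  intertwines e rho pi (window sone flat_height) p ->
  (forall x, rnorm (rho p x) <= M * rnorm x) ->
  forall v, rnorm (pi p v) <= 2 * M * rnorm v.
Proof.
move=> M0 hp1 hp2 hM v.
rewrite -ler_sqr ?nnegrE ?mulr_ge0 ?rnorm_ge0 //.
apply/ler_addgt0Pr => eps e0; have e2 : 0 < eps / 2 by rewrite divr_gt0.
have [N1 h1] := intertwines_bound e_on hp1 hM v e2.
have [N2 h2] := intertwines_bound e_on hp2 hM v e2.
pose N := (maxn N1 N2).+1.
have {h1} h1 := h1 N (leqW (leq_maxl _ _)); have {h2} h2 := h2 N (leqW (leq_maxr _ _)).
have /andP[h3 _] := window_flat_sum (pi p v) (ltn0Sn (maxn N1 N2)).
have /andP[_ h4] := window_flat_sum v (ltn0Sn (maxn N1 N2)).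
rewrite !window_vacuum_sum in h1.
have M2 := sqr_ge0 M; have h5 := ler_wpM2l M2 h4.
have h6 := ler_wpM2l M2 (sqr_ge0 (rnorm (pi (spow V N) v))).
rewrite mulr0 in h6; rewrite -/N in h3 h5; rewrite 2!exprMn.
move: h1 h2 h3 h5 h6; rewrite -!(mulrA 2) mulrBr.
move: (M ^+ 2 * rnorm v ^+ 2) (M ^+ 2 * _) (M ^+ 2 * _) => x y z.
move: (\sum_(k < N) _) (rnorm (pi (spow V N) (pi p v)) ^+ 2) (rnorm (pi p v) ^+ 2) => a b d.
lra.
Qed.
End Toeplitz.

Section DiscFock.
Variables (R : realType).
Local Notation C := (Cfield R).
Variables (s : R) (s01 : 0 < s < 1).

(** The relation gives |T|^2 <= s |T|^2 + (1 - s). *)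
Lemma disc_rel_contractive (A : cstarAlgType C) (T : A) :
  star T ** T = (s%:C)%C *: (T ** star T) + ((1 - s)%:C)%C *: sone -> rnorm T <= 1.
Proof.
have /andP[s0 s1] := s01; move=> rT; have := rnorm_cstar T; rewrite rT => h.
have := rnormD ((s%:C)%C *: (T ** star T)) (((1 - s)%:C)%C *: sone).
have s1' : 0 < 1 - s by rewrite subr_gt0.
have TTs : rnorm (T ** star T) = rnorm T ^+ 2 by rewrite -{1}[T]starK rnorm_cstar rnorm_star.
rewrite h !rnormZr (gtr0_norm s0) (gtr0_norm s1') TTs => h1.
have h2 := ler_wpM2l (ltW s1') (rnorm1_le A).
rewrite -(@ler_sqr _ _ 1) ?nnegrE ?rnorm_ge0 // expr1n -(ler_pM2l s1'); lra.
Qed.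

(** With D = 1 - x x^* one has D x = s x D, hence D^* D = D - s x D x^*; both D and
x D x^* are positive, and D <= 1. *)
Lemma disc_defect_contractive (A : starAlgType C) (K : hilbertType C)
    (pi : A -> K -> K) (x : A) : is_star_rep pi ->
  star x ** x = (s%:C)%C *: (x ** star x) + ((1 - s)%:C)%C *: sone ->
  (forall v, rnorm (pi (star x) v) <= rnorm v) ->
  forall v, rnorm (pi (sone - x ** star x) v) <= rnorm v.
Proof.
move=> hpi rx x1 v; set D := sone - x ** star x.
have sD : star D = D by rewrite starB star1 starM starK.
have formD u : inner (pi D u) u =
    ((rnorm u ^+ 2 - rnorm (pi (star x) u) ^+ 2)%:C)%C.
  rewrite (repB hpi) (rep1 hpi) innerBl inner_rnorm rmorphB /=; congr (_ - _).
  by rewrite (rnorm_rep_star_mul hpi) starK.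
have Dx : D ** x = (s%:C)%C *: (x ** D).
  have xx : sone - star x ** x = (s%:C)%C *: D.
    by rewrite rx rmorphB /= scalerBl scale1r scalerBr opprD opprB addrC -addrA subrK addrC.
  by rewrite -smulZr -xx smulBl smulBr smul1 smulr1 smulA.
have DD : star D ** D = D - (s%:C)%C *: (x ** D ** star x).
  by rewrite sD {2}/D smulBr smulr1 smulA Dx smulZl.
rewrite -ler_sqr ?nnegrE ?rnorm_ge0 // -lecR (rnorm_rep_star_mul hpi) DD.
rewrite (repB hpi) (repZ hpi) !(repM hpi) innerBl innerZ formD.
rewrite (rep_star hpi (x)) formD -rmorphM -rmorphB lecR /=.
set y := pi (star x) v.
have h1 : 0 <= rnorm y ^+ 2 - rnorm (pi (star x) y) ^+ 2.
  by rewrite subr_ge0 ler_sqr ?nnegrE ?rnorm_ge0.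
have s0 : 0 <= s by case/andP: s01 => /ltW.
have := mulr_ge0 s0 h1; have := sqr_ge0 (rnorm y); lra.
Qed.

Variables (CD : cstarAlgType C) (iD : PDisc ((s%:C)%C : C) -> CD).
Hypothesis hD : is_cstar_closure iD.
Local Notation x := (disc_x ((s%:C)%C : C)).
Local Notation T := (iD x).
Let D_hom := closure_hom hD.

Let x_rel : star x ** x = (s%:C)%C *: (x ** star x) + ((1 - s)%:C)%C *: sone.
Proof. by rewrite disc_xP rmorphB. Qed.

Let T_rel : star T ** T = (s%:C)%C *: (T ** star T) + ((1 - s)%:C)%C *: sone.
Proof.
rewrite -(star_hom_star D_hom) -!(star_homM D_hom) x_rel -(star_hom1 D_hom).
by rewrite -2!(star_homZ D_hom) (star_homD D_hom).
Qed.

Let D_le1 : rnorm (sone - T ** star T) <= 1.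
Proof.
have -> : sone - T ** star T = iD (sone - x ** star x).
  by rewrite (star_homB _ _ D_hom) (star_homM D_hom) (star_hom_star D_hom) (star_hom1 D_hom).
apply: (closure_norm_le hD) => K pi v hpi v1; apply: le_trans v1.
apply: (disc_defect_contractive hpi x_rel) => u.
apply: le_trans (closure_rep_le hD _ _ hpi) _.
rewrite ler_piMl ?rnorm_ge0 // (star_hom_star D_hom) rnorm_star.
exact: disc_rel_contractive.
Qed.

Variables (H : hilbertType C) (e : nat -> H) (rho : CD -> H -> H).
Hypothesis e_on : forall n, orthonormal n e.
Hypothesis hrho : is_star_rep rho.
Hypothesis rhoT : forall k, rho T (e k) = ((weight s k)%:C)%C *: e k.+1.
Hypothesis rhoTs0 : rho (star T) (e 0%N) = 0.
Hypothesis rhoTs : forall k, rho (star T) (e k.+1) = ((weight s k)%:C)%C *: e k.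

(** The Fock representation is faithful on the disc algebra: an arbitrary
representation is compared with it along the two windows, which intertwine the
generator and therefore every element of the *-algebra. *)
Lemma disc_fock_bound p (M : R) : 0 <= M ->
  (forall v, rnorm (rho (iD p) v) <= M * rnorm v) -> rnorm (iD p) <= 2 * M.
Proof.
move=> M0 hM; apply: (closure_norm_le hD) => K pi v hpi v1.
have [E [hE Ei]] := closure_rep hD hpi; rewrite -Ei.
have [V [h [VV TVh sh PVh Vh]]] := disc_polar s01 T_rel D_le1.
have all_intertwined X c : intertwines e rho E (window V E X c) T ->
    intertwines e rho E (window V E X c) (star T) ->
    forall p, intertwines e rho E (window V E X c) (iD p).
  move=> iT iTs; have lin := window_linear V hE X c.
  apply: disc_ind => [|a y|y z|y z||].
  - by rewrite (star_hom1 D_hom); apply: intertwines1.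
  - by rewrite (star_homZ D_hom); apply: intertwinesZ.
  - by rewrite (star_homD D_hom); apply: intertwinesD.
  - by rewrite (star_homM D_hom); apply: intertwinesM.
  - by [].
  - by rewrite (star_hom_star D_hom).
have i1 := all_intertwined _ _
  (vacuum_intertwines_T s01 VV TVh PVh e_on hrho hE rhoT)
  (vacuum_intertwines_starT s01 VV TVh sh PVh e_on hrho hE rhoTs0 rhoTs) p.
have i2 := all_intertwined _ _
  (flat_intertwines_T s01 VV TVh Vh e_on hrho hE rhoT)
  (flat_intertwines_starT s01 VV TVh sh Vh e_on hrho hE rhoTs0 rhoTs) p.
apply: le_trans (toeplitz_domination VV e_on hE M0 i1 i2 hM v) _.
by rewrite ler_piMr // mulr_ge0.
Qed.
End DiscFock.

(** * The disc algebra as the invariants of the sphere algebra *)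

(** Below, Dd and S stand for the *-algebras of the disc and of the sphere, and t
for q^2. *)

Section SphereDisc.
Variables (C : numClosedFieldType) (Dd S : starAlgType C).
Variables (x : Dd) (A B : S) (t : C) (phi : Dd -> S).
Hypothesis disc_ind : forall P : Dd -> Prop,
  P sone -> (forall (c : C) a, P a -> P (c *: a)) ->
  (forall a b, P a -> P b -> P (a + b)) -> (forall a b, P a -> P b -> P (a ** b)) ->
  P x -> P (star x) -> forall a, P a.
Hypothesis sphere_ind : forall P : S -> Prop,
  P sone -> (forall (c : C) a, P a -> P (c *: a)) ->
  (forall a b, P a -> P b -> P (a + b)) -> (forall a b, P a -> P b -> P (a ** b)) ->
  P A -> P B -> P (star A) -> P (star B) -> forall a, P a.
Hypotheses (t0 : t != 0) (treal : t^* = t).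
Hypotheses (starA : star A = A) (BA : B ** A = t *: (A ** B))
  (BsB : star B ** B = - (A ** A) + sone).
Hypotheses (hphi : is_star_hom phi) (phix : phi x = star B).

Lemma phi_starx : phi (star x) = B.
Proof. by rewrite (star_hom_star hphi) phix starK. Qed.

Lemma A_starB : A ** star B = t *: (star B ** A).
Proof.
by have := congr1 star BA; rewrite starM starZ starM starA => ->; rewrite treal.
Qed.

(** A commutes with B and B^* up to the scalars t and t^-1. *)
Lemma phi_A_swap d : exists d', phi d ** A = A ** phi d'.
Proof.
move: d; apply: disc_ind.
- by exists sone; rewrite (star_hom1 hphi) smul1 smulr1.
- move=> c a [a' ha]; exists (c *: a').
  by rewrite (star_homZ hphi c a) (star_homZ hphi c a') smulZl smulZr ha.
- move=> a b [a' ha] [b' hb]; exists (a' + b').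
  by rewrite (star_homD hphi a b) (star_homD hphi a' b') smulDl smulDr ha hb.
- move=> a b [a' ha] [b' hb]; exists (a' ** b').
  by rewrite (star_homM hphi a b) (star_homM hphi a' b') -smulA hb !smulA ha.
- exists (t^-1 *: x); rewrite (star_homZ hphi _ x) phix smulZr A_starB.
  by rewrite scalerA mulVf // scale1r.
- by exists (t *: star x); rewrite (star_homZ hphi _ (star x)) phi_starx smulZr BA.
Qed.

(** A can be moved to the left, and A A = 1 - B^* B lies in the range of phi. *)
Lemma sphere_decomposition p : exists d0 d1, p = phi d0 + A ** phi d1.
Proof.
have h0 := star_hom0 hphi; have h1 := star_hom1 hphi.
have AA : A ** A = phi (sone - x ** star x).
  rewrite (star_homB sone (x ** star x) hphi) (star_homM hphi x (star x)) h1 phix phi_starx BsB.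
  by rewrite opprD opprK addrCA subrr addr0.
move: p; apply: sphere_ind.
- by exists sone, 0; rewrite h0 h1 smul0r addr0.
- move=> c _ [a0 [a1 ->]]; exists (c *: a0), (c *: a1).
  by rewrite (star_homZ hphi c a0) (star_homZ hphi c a1) smulZr scalerDr.
- move=> _ _ [a0 [a1 ->]] [b0 [b1 ->]]; exists (a0 + b0), (a1 + b1).
  by rewrite (star_homD hphi a0 b0) (star_homD hphi a1 b1) smulDr addrACA.
- move=> _ _ [a0 [a1 ->]] [b0 [b1 ->]].
  have [a0' ha0] := phi_A_swap a0; have [a1' ha1] := phi_A_swap a1.
  exists (a0 ** b0 + (sone - x ** star x) ** (a1' ** b1)), (a0' ** b1 + a1 ** b0).
  rewrite (star_homD hphi (a0 ** b0)) (star_homD hphi (a0' ** b1)).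
  rewrite (star_homM hphi (sone - _)) -AA (star_homM hphi a0 b0) (star_homM hphi a1' b1).
  rewrite (star_homM hphi a0' b1) (star_homM hphi a1 b0).
  rewrite smulDl !smulDr [RHS]addrACA; congr (_ + _ + _).
    by rewrite smulA ha0 smulA.
  rewrite addrC smulA -[A ** phi a1 ** A]smulA ha1 !smulA; congr (_ + _).
- by exists 0, sone; rewrite h0 h1 smulr1 add0r.
- by exists (star x), 0; rewrite h0 phi_starx smul0r addr0.
- by exists 0, sone; rewrite h0 h1 smulr1 add0r starA.
- by exists x, 0; rewrite h0 phix smul0r addr0.
Qed.

Variables (r1 : S -> S) (hr1 : is_star_hom r1).
Hypotheses (r1A : r1 A = - A) (r1B : r1 B = B).

Lemma r1_phi d : r1 (phi d) = phi d.
Proof.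
move: d; apply: disc_ind.
- by rewrite (star_hom1 hphi) (star_hom1 hr1).
- by move=> c a ha; rewrite (star_homZ hphi c a) (star_homZ hr1 c (phi a)) ha.
- by move=> a b ha hb; rewrite (star_homD hphi a b) (star_homD hr1 (phi a)) ha hb.
- by move=> a b ha hb; rewrite (star_homM hphi a b) (star_homM hr1 (phi a)) ha hb.
- by rewrite phix (star_hom_star hr1) r1B.
- by rewrite phi_starx r1B.
Qed.

(** In the decomposition phi d0 + A phi d1, r1 changes the sign of the second term. *)
Lemma r1_fixed p : r1 p = p <-> exists d, p = phi d.
Proof.
split=> [|[d ->]]; last exact: r1_phi.
have [d0 [d1 ->]] := sphere_decomposition p.
rewrite (star_homD hr1 (phi d0)) (star_homM hr1 A) (r1_phi d0) (r1_phi d1) r1A smulNl => /addrI h.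
exists d0; set u := A ** phi d1 in h *.
have : (2 : C) *: u = 0 by rewrite scaler_nat mulr2n -{1}h addNr.
by move=> /eqP; rewrite scaler_eq0 pnatr_eq0 /= => /eqP ->; rewrite addr0.
Qed.

Lemma r1_involutive p : r1 (r1 p) = p.
Proof.
have [d0 [d1 ->]] := sphere_decomposition p.
have r1E : r1 (phi d0 + A ** phi d1) = phi d0 - A ** phi d1.
  by rewrite (star_homD hr1 (phi d0)) (star_homM hr1 A) (r1_phi d0) (r1_phi d1) r1A smulNl.
rewrite r1E (star_homB _ _ hr1) (star_homM hr1 A) (r1_phi d0) (r1_phi d1) r1A.
by rewrite smulNl opprK.
Qed.
End SphereDisc.

(** * Completions, and joint faithfulness of the two sphere representations *)

Section Final.
Variables (R : realType) (q : R).
Local Notation C := (Cfield R).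
Local Notation s := (q ^+ 4).
Local Notation qC := ((q%:C)%C : C).
Local Notation sC := ((s%:C)%C : C).
Local Notation x := (disc_x sC).
Local Notation A := (sphereA qC).
Local Notation B := (sphereB qC).

Hypothesis hq : 0 < `|q| < 1.

Lemma q4_01 : 0 < s < 1.
Proof.
have /andP[q0 q1] := hq.
have -> : s = `|q| ^+ 4 by rewrite -normrX ger0_norm // exprn_even_ge0.
by rewrite exprn_gt0 //= expr_lt1.
Qed.

Lemma q_square_conj : qC ^+ 2 != 0 /\ (qC ^+ 2)^* = qC ^+ 2.
Proof.
split; last by rewrite rmorphXn /= conjC_real.
by rewrite expf_neq0 // (inj_eq (@complexI _)) -normr_gt0; case/andP: hq.
Qed.

(** x = B^* satisfies the disc relation, as B B^* - q^4 B^* B = 1 - q^4. *)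
Lemma disc_to_sphere : exists2 phi : PDisc sC -> PSphere qC,
  is_star_hom phi & phi x = star B.
Proof.
apply: disc_lift; rewrite starK sphere_BsB sphere_BBs.
have -> : qC ^+ 4 = sC by rewrite rmorphXn.
move: (sphereA qC ** sphereA qC) => a.
rewrite scalerDr scalerN -addrA; congr (_ + _).
by rewrite -scalerDl addrC subrK scale1r.
Qed.

Variables (CS : cstarAlgType C) (iS : PSphere qC -> CS) (hS : is_cstar_closure iS).
Variables (CD : cstarAlgType C) (iD : PDisc sC -> CD) (hD : is_cstar_closure iD).
Variables (H : hilbertType C) (e : nat -> H) (he : orthonormal_basis e).
Let S_hom := closure_hom hS.

Lemma rep_B_weights sgn pi : is_sphere_rep iS e sgn pi -> forall k,
  pi (iS B) (e k.+1) = ((weight s k)%:C)%C *: e k.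
Proof.
move=> hpi k; rewrite (sphere_repB hpi).
have -> : 1 - qC ^+ (4 * k.+1) = ((1 - s ^+ k.+1)%:C)%C.
  by rewrite rmorphB exprM /= !rmorphXn.
by rewrite sqrtC_of_real // subr_ge0 (pow_s_le1 q4_01).
Qed.

Lemma rep_starB_weights sgn pi : is_sphere_rep iS e sgn pi -> forall k,
  pi (star (iS B)) (e k) = ((weight s k)%:C)%C *: e k.+1.
Proof.
move=> hpi k; have hr := sphere_rep hpi; have [on _] := he.
apply/eqP; rewrite -subr_eq0; apply/eqP/(basis_inner_eq0 he) => j.
rewrite innerBl (rep_starl hr) innerZ on.
case: j => [|j]; first by rewrite (sphere_repB0 hpi) inner0r mulr0 subrr.
rewrite (rep_B_weights hpi) innerZr on conjC_real eqSS.
by case: eqVneq => [->|_]; rewrite ?subrr // !mulr0 subrr.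
Qed.

(** A bounded operator is determined by its values on e, and it determines its
adjoint. *)
Lemma sphere_rep_unique (rho rho' : CS -> H -> H) :
  is_star_rep rho -> is_star_rep rho' ->
  (forall k, rho (iS A) (e k) = rho' (iS A) (e k)) ->
  (forall k, rho (iS B) (e k) = rho' (iS B) (e k)) ->
  forall b v, rho b v = rho' b v.
Proof.
move=> hr hr' eA eB.
have from_basis b : (forall k, rho b (e k) = rho' b (e k)) ->
    forall v, rho b v = rho' b v.
  move=> eb v; apply/eqP; rewrite -subr_eq0; apply/eqP.
  apply: (@basis_eq0 _ _ _ he (fun v => rho b v - rho' b v) (rnorm b + rnorm b)).
  - by move=> c u w /=; rewrite (rep_linear hr) (rep_linear hr') scalerBr opprD addrACA.
  - move=> u; apply: le_trans (rnormB _ _) _; rewrite mulrDl.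
    by apply: lerD; apply: rep_contractive.
  - by move=> k; rewrite eb subrr.
have from_star b : (forall v, rho b v = rho' b v) ->
    forall v, rho (star b) v = rho' (star b) v.
  by move=> hb v; apply: inner_inj => w; rewrite (rep_starl hr) (rep_starl hr') hb.
have on_P : forall p v, rho (iS p) v = rho' (iS p) v.
  apply: sphere_ind => [v|c a ha v|a b ha hb v|a b ha hb v|||v|v].
  - by rewrite (star_hom1 S_hom) (rep1 hr) (rep1 hr').
  - by rewrite (star_homZ S_hom c a) (repZ hr) (repZ hr') ha.
  - by rewrite (star_homD S_hom a b) (repD hr) (repD hr') ha hb.
  - by rewrite (star_homM S_hom a b) (repM hr) (repM hr') ha hb.
  - exact: from_basis.
  - exact: from_basis.
  - by rewrite (star_hom_star S_hom A); apply/from_star/from_basis.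
  - by rewrite (star_hom_star S_hom B); apply/from_star/from_basis.
move=> b v; apply/eqP; rewrite -subr_eq0; apply/eqP; move: b.
apply: (dense_eq0 hS (M := rnorm v + rnorm v)).
- by move=> a b; rewrite (repD hr) (repD hr') opprD addrACA.
- move=> b; apply: le_trans (rnormB _ _) _; rewrite mulrDl ![rnorm v * _]mulrC.
  by apply: lerD; apply: rep_contractive.
- by move=> p; rewrite on_P subrr.
Qed.

(** In any representation r1 (p^* p) is positive. *)
Lemma sphere_square_le (r1 : PSphere qC -> PSphere qC) p : is_star_hom r1 ->
  rnorm (iS p) ^+ 2 <= rnorm (iS (star p ** p + r1 (star p ** p))).
Proof.
move=> hr1; set b := star p ** p + _.
suff : rnorm (iS p) <= Num.sqrt (rnorm (iS b)).
  by rewrite -ler_sqr ?nnegrE ?rnorm_ge0 ?sqrtr_ge0 // sqr_sqrtr ?rnorm_ge0.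
apply: (closure_norm_le hS) => K pi v hpi v1.
rewrite -(ger0_norm (rnorm_ge0 (pi p v))) -sqrtr_sqr ler_wsqrtr //.
have h1 : rnorm (pi p v) ^+ 2 + rnorm (pi (r1 p) v) ^+ 2 <= cabs (inner (pi b v) v).
  rewrite /b (repD hpi) innerD (star_homM hr1) (star_hom_star hr1).
  by rewrite -!(rnorm_rep_star_mul hpi) -rmorphD cabs_real ler_norm.
have h2 := cauchy_schwarz (pi b v) v.
have h3 := closure_rep_le hS b v hpi.
have h4 := sqr_ge0 (rnorm (pi (r1 p) v)); have h5 := rnorm_ge0 (iS b).
have h6 := rnorm_ge0 v; have h7 := rnorm_ge0 (pi b v).
have h8 : rnorm (pi b v) * rnorm v <= rnorm (pi b v) by rewrite ler_piMr.
have h9 : rnorm (iS b) * rnorm v <= rnorm (iS b) by rewrite ler_piMr.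
lra.
Qed.

(** The inequality of sphere_square_le, at the limit. *)
Lemma average_square_eq0 (r1 : PSphere qC -> PSphere qC) (rb : CS -> CS) a :
  is_star_hom r1 -> is_star_hom rb -> (forall p, rb (iS p) = iS (r1 p)) ->
  (forall b, rnorm (rb b) <= rnorm b) ->
  star a ** a + rb (star a ** a) = 0 -> a = 0.
Proof.
move=> hr1 hrb rbi rb1 a0.
suff : rnorm a ^+ 2 <= 0.
  by rewrite -[X in _ <= X](expr0n R 2) ler_sqr ?nnegrE ?rnorm_ge0 // => h;
    apply/rnorm0_eq0/eqP; rewrite eq_le h rnorm_ge0.
apply/ler_addgt0Pr => eps e0; rewrite add0r.
(* If |a - iS p| <= d <= 1, then |a|^2 <= (6 |a| + 5) d. *)
set n := rnorm a; have n0 : 0 <= n by apply: rnorm_ge0.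
have K0 : 0 < 6 * n + 5 by rewrite ltr_wpDl // mulr_ge0.
pose d := Num.min 1 (eps / (6 * n + 5)).
have d0 : 0 < d by rewrite lt_min ltr01 divr_gt0.
have d1 : d <= 1 by rewrite ge_min lexx.
have de : d * (6 * n + 5) <= eps by rewrite -ler_pdivlMr // ge_min lexx orbT.
have [p hp] := closure_approx hS a d0; have dge := ltW hp.
set u := iS p in hp dge; set t := rnorm u; have t0 : 0 <= t by apply: rnorm_ge0.
have sq := sphere_square_le p hr1.
have diff : rnorm (star u ** u - star a ** a) <= (t + n) * d.
  have -> : star u ** u - star a ** a = star u ** (u - a) + star (u - a) ** a.
    by rewrite smulBr starB smulBl addrA subrK.
  apply: le_trans (rnormD _ _) _; rewrite mulrDl [n * d]mulrC.
  by apply: lerD; apply: le_trans (rnormM _ _) _; rewrite rnorm_star;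
    apply: ler_pM; rewrite ?rnorm_ge0 // rdistC.
have main : t ^+ 2 <= (t + n) * d + (t + n) * d.
  apply: (le_trans sq); rewrite (star_homD S_hom) -rbi (star_homM S_hom) (star_hom_star S_hom).
  rewrite -/u -[X in rnorm X]subr0 -a0 opprD addrACA -(star_homB _ _ hrb).
  apply: le_trans (rnormD _ _) _; apply: lerD => //.
  by apply: le_trans (rb1 _) _.
have nt : n <= t + d.
  have := rdistD u a 0; rewrite !subr0 => h; apply: (le_trans h).
  by rewrite addrC lerD2l.
have tn : t <= n + d.
  have := rdistD a u 0; rewrite !subr0 => h; apply: (le_trans h).
  by rewrite addrC lerD2l rdistC.
apply: le_trans de; nra.
Qed.

Section Invariants.
Variables (phi : PDisc sC -> PSphere qC) (hphi : is_star_hom phi).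
Hypothesis phix : phi x = star B.
Variables (F : CD -> CS) (hF : is_star_hom F).
Hypotheses (Fi : forall d, F (iD d) = iS (phi d)) (F1 : forall c, rnorm (F c) <= rnorm c).
Variables (r1 : PSphere qC -> PSphere qC) (hr1 : is_star_hom r1).
Hypotheses (r1A : r1 A = - A) (r1B : r1 B = B).
Variables (rbar : CS -> CS) (hrbar : is_star_hom rbar).
Hypotheses (rbar_i : forall p, rbar (iS p) = iS (r1 p))
  (rbar1 : forall b, rnorm (rbar b) <= rnorm b).
Variables (pip pim : CS -> H -> H).
Hypotheses (hpip : is_sphere_rep iS e 1 pip) (hpim : is_sphere_rep iS e (-1) pim).
Let hp := sphere_rep hpip.
Let hm := sphere_rep hpim.

Let r1_fixed_phi p : r1 p = p <-> exists d, p = phi d.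
Proof.
have [q20 q2r] := q_square_conj.
exact: (r1_fixed (@disc_ind C sC) (@sphere_ind C qC) q20 q2r (sphere_starA qC)
  (sphere_BA qC) (sphere_BsB qC) hphi phix hr1 r1A r1B).
Qed.

Let r1K p : r1 (r1 p) = p.
Proof.
have [q20 q2r] := q_square_conj.
exact: (r1_involutive (@disc_ind C sC) (@sphere_ind C qC) q20 q2r (sphere_starA qC)
  (sphere_BA qC) (sphere_BsB qC) hphi phix hr1 r1A r1B).
Qed.

(** The Fock representation of the disc algebra is the restriction of pi_+. *)
Lemma disc_le_pip c (M : R) : 0 <= M ->
  (forall v, rnorm (pip (F c) v) <= M * rnorm v) -> rnorm c <= 2 * M.
Proof.
move=> M0 hM; have hpF := star_rep_comp hF hp.
have e_on n : orthonormal n e by apply: basis_orthonormal.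
have FT : F (iD x) = star (iS B) by rewrite Fi phix (star_hom_star S_hom).
have FTs : F (star (iD x)) = iS B by rewrite (star_hom_star hF) FT starK.
have rT k : (pip \o F) (iD x) (e k) = ((weight s k)%:C)%C *: e k.+1.
  by rewrite /= FT (rep_starB_weights hpip).
have rT0 : (pip \o F) (star (iD x)) (e 0%N) = 0.
  by rewrite /= FTs (sphere_repB0 hpip).
have rTs k : (pip \o F) (star (iD x)) (e k.+1) = ((weight s k)%:C)%C *: e k.
  by rewrite /= FTs (rep_B_weights hpip).
apply/ler_addgt0Pr => eps e0.
have e3 : 0 < eps / 3 by rewrite divr_gt0.
have [p cp] := closure_approx hD c e3.
have : rnorm (iD p) <= 2 * (M + eps / 3).
  apply: (disc_fock_bound q4_01 hD e_on hpF rT rT0 rTs).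
    by rewrite addr_ge0 // ltW.
  move=> v /=; have -> : F (iD p) = F c + F (iD p - c).
    by rewrite (star_homB _ _ hF) addrC subrK.
  rewrite (repD hp) mulrDl; apply: le_trans (rnormD _ _) _.
  apply: lerD; first exact: hM.
  apply: le_trans (rep_contractive hp _ _) _; rewrite ler_wpM2r ?rnorm_ge0 //.
  by apply: le_trans (F1 _) _; rewrite rdistC ltW.
have := rdistD (iD p) c 0; rewrite !subr0 => h1 h2; lra.
Qed.

Lemma disc_embedding_lower c : rnorm c <= 2 * rnorm (F c).
Proof. by apply: disc_le_pip => [|v]; [exact: rnorm_ge0|exact: rep_contractive]. Qed.

Lemma disc_embedding_inj a b : F a = F b -> a = b.
Proof.
move=> ab; apply/eqP; rewrite -subr_eq0; apply/eqP/rnorm0_eq0/eqP.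
rewrite eq_le rnorm_ge0 andbT (le_trans (disc_embedding_lower _)) //.
by rewrite (star_homB _ _ hF) ab subrr rnorm0 mulr0.
Qed.

Lemma rbarK b : rbar (rbar b) = b.
Proof.
apply/eqP; rewrite -subr_eq0; apply/eqP; move: b.
apply: (dense_eq0 hS (M := 2)).
- by move=> a b; rewrite !(star_homD hrbar) opprD addrACA.
- move=> b; apply: le_trans (rnormB _ _) _; rewrite mulr_natl mulr2n.
  by apply: lerD => //; apply: le_trans (rbar1 _) (rbar1 _).
- by move=> p; rewrite !rbar_i r1K subrr.
Qed.

Lemma pip_rbar b v : pip (rbar b) v = pim b v.
Proof.
apply: (sphere_rep_unique (star_rep_comp hrbar hp) hm) => k /=.
  rewrite rbar_i r1A (star_homN _ S_hom) -scaleN1r (repZ hp) (sphere_repA hpip).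
  by rewrite (sphere_repA hpim) scalerA mulrA mulr1.
rewrite rbar_i r1B; case: k => [|k].
  by rewrite (sphere_repB0 hpip) (sphere_repB0 hpim).
by rewrite (rep_B_weights hpip) (rep_B_weights hpim).
Qed.

Lemma pim_rbar b v : pim (rbar b) v = pip b v.
Proof. by rewrite -pip_rbar rbarK. Qed.

Lemma rbar_disc c : rbar (F c) = F c.
Proof.
apply/eqP; rewrite -subr_eq0; apply/eqP; move: c.
apply: (dense_eq0 hD (M := 2)).
- by move=> a b; rewrite (star_homD hF) (star_homD hrbar) opprD addrACA.
- move=> b; apply: le_trans (rnormB _ _) _; rewrite mulr_natl mulr2n.
  by apply: lerD => //; apply: le_trans (rbar1 _) (F1 _).
- move=> d; rewrite !Fi rbar_i; have [_ ->] := r1_fixed_phi (phi d).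
    by rewrite subrr.
  by exists d.
Qed.

Lemma closure_invariants_sub_disc b :
  closure (iS @` [set p | r1 p = p]) b -> exists c, F c = b.
Proof.
move=> hb; apply: (closed_range (M := 2)) => //.
- by move=> u v; rewrite (star_homB _ _ hF).
- exact: disc_embedding_lower.
- by move: hb; apply: closureS => _ [p /r1_fixed_phi[d ->] <-]; exists (iD d).
Qed.

(** If rbar b = b and p is close to b, then so is the invariant (p + r1 p) / 2. *)
Lemma rbar_fixed_closure b :
  rbar b = b -> closure (iS @` [set p | r1 p = p]) b.
Proof.
move=> bb; apply/closure_rnormP => eps e0.
have [p hp'] := closure_approx hS b e0.
have [u [r1u iu]] : exists u, r1 u = u /\ iS u = iS p + iS (r1 p).
  exists (p + r1 p); rewrite (star_homD S_hom p (r1 p)); split=> //.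
  by rewrite (star_homD hr1 p (r1 p)) r1K; exact: addrC.
pose h : C := ((2^-1 : R)%:C)%C.
have hh (v : CS) : h *: (v + v) = v.
  rewrite scalerDr -scalerDl -rmorphD /=.
  by rewrite (_ : 2^-1 + 2^-1 = 1) ?scale1r //; lra.
exists (iS (h *: u)).
  by exists (h *: u); last by []; move: (star_homZ hr1 h u); rewrite r1u.
have -> : b - iS (h *: u) = h *: ((b - iS p) + rbar (b - iS p)).
  rewrite (star_homB b _ hrbar) bb rbar_i addrACA -opprD -iu scalerBr hh.
  by rewrite (star_homZ S_hom h u).
rewrite rnormZr ger0_norm ?invr_ge0 //.
have := rnormD (b - iS p) (rbar (b - iS p)); have := rbar1 (b - iS p); lra.
Qed.

(** The symmetrization of a^* a lies in the disc algebra, where pi_+ alone is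
faithful. *)
Lemma rep_pair_faithful a :
  (forall v, pip a v = 0) -> (forall v, pim a v = 0) -> a = 0.
Proof.
move=> a_p a_m; pose b := star a ** a + rbar (star a ** a).
have bfix : rbar b = b by rewrite /b (star_homD hrbar) rbarK addrC.
have [c cb] := closure_invariants_sub_disc (rbar_fixed_closure bfix).
have pb v : pip b v = 0.
  rewrite /b (repD hp) pip_rbar !(repM hp) !(repM hm) a_p a_m.
  by rewrite (rep_x0 hp) (rep_x0 hm) addr0.
have c0 : c = 0.
  apply/rnorm0_eq0/eqP; rewrite eq_le rnorm_ge0 andbT -[X in _ <= X](mulr0 2).
  by apply: disc_le_pip => // v; rewrite cb pb rnorm0 mul0r.
apply: (average_square_eq0 hr1 hrbar rbar_i rbar1).
by rewrite -/b -cb c0 (star_hom0 hF).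
Qed.

(** rbar exchanges pip and pim, so the flip of rep_sum a is rep_sum (rbar a). *)
Lemma r1_barE a : r1_bar pip pim a = rbar a.
Proof.
have inj : {in [set: CS] &, injective (rep_sum pip pim)}.
  move=> u v _ _ [up um]; apply/eqP; rewrite -subr_eq0; apply/eqP/rep_pair_faithful => w.
    by rewrite (repB hp) up subrr.
  by rewrite (repB hm) um subrr.
rewrite -[LHS]/(pinv_ (fun=> 0) [set: CS] (rep_sum pip pim) (flip (rep_sum pip pim a))).
have -> : flip (rep_sum pip pim a) = rep_sum pip pim (rbar a).
  by rewrite /flip /rep_sum /=; congr (_, _); apply/funext => v; rewrite ?pip_rbar ?pim_rbar.
exact: (@pinvKV _ _ (fun=> 0) [set: CS] _ inj (rbar a) (mem_set I)).
Qed.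
End Invariants.
End Final.

Theorem proposition3p3 (R : realType) (q : R) (hq : 0 < `|q| < 1)
    (* C(S^2_q), the C*-closure of P(S^2_q) *)
    (CS : cstarAlgType (Cfield R)) (iS : PSphere (q%:C)%C -> CS)
    (hS : is_cstar_closure iS)
    (* C(D_s) for s = q^4, the C*-closure of P(D_s) *)
    (CD : cstarAlgType (Cfield R)) (iD : PDisc ((q ^+ 4)%:C)%C -> CD)
    (hD : is_cstar_closure iD)
    (* the automorphism r_1 of P(S^2_q) *)
    (r1 : PSphere (q%:C)%C -> PSphere (q%:C)%C)
    (hr1 : is_star_hom r1) (r1_bij : bijective r1)
    (r1A : r1 (sphereA (q%:C)%C) = - sphereA (q%:C)%C)
    (r1B : r1 (sphereB (q%:C)%C) = sphereB (q%:C)%C)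
    (* the representations pi_+ and pi_- of C(S^2_q) *)
    (H : hilbertType (Cfield R)) (e : nat -> H) (he : orthonormal_basis e)
    (pip pim : CS -> H -> H)
    (hpip : is_sphere_rep iS e 1 pip) (hpim : is_sphere_rep iS e (-1) pim) :
  [set a : CS | r1_bar pip pim a = a] = closure (iS @` [set p | r1 p = p]) /\
  exists f : CD -> CS, is_star_hom f /\
    set_bij [set: CD] [set a : CS | r1_bar pip pim a = a] f.
Proof.
have [phi hphi phix] := disc_to_sphere q.
have [F [hF Fi F1]] := closure_extend_hom hD hS hphi.
have [rbar [hrbar rbar_i rbar1]] := closure_extend_hom hS hS hr1.
have barE := r1_barE hq hS hD he hphi phix hF Fi F1 hr1 r1A r1B hrbar rbar_i rbar1 hpip hpim.
have fixC := rbar_fixed_closure hq hS hphi phix hr1 r1A r1B hrbar rbar_i rbar1.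
have clD := closure_invariants_sub_disc hq hS hD he hphi phix hF Fi F1 hr1 r1A r1B hpip.
have Dfix := rbar_disc hq hD hphi phix hF Fi F1 hr1 r1A r1B hrbar rbar_i rbar1.
have -> : [set a : CS | r1_bar pip pim a = a] = [set a | rbar a = a].
  by apply/seteqP; split=> a /=; rewrite barE.
split.
  apply/seteqP; split=> b /=; first exact: fixC.
  by move=> /clD[c <-]; exact: Dfix.
exists F; split=> //; split.
- by move=> c _; apply: Dfix.
- by move=> u v _ _; apply: (disc_embedding_inj hq hS hD he phix hF Fi F1 hpip).
- by move=> b /= /fixC /clD[c <-]; exists c.
Qed.
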